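(* Let $g_1,\dots,g_m\in\mathcal{C}^\infty(\mathbb{R}^n;\mathbb{R}^n)$ and $x_0\in\mathbb{R}^n$. Assume that the Lie algebra $L(g_1,\dots,g_m)$ is finitely generated with respect to orbits of origin $x_0$, and let $\{Y_1,\dots,Y_M\}\subseteq L(g_1,\dots,g_m)$ be a fixed system of generators. Let $G_i(t)(x)=G_i(t;x)$ be the local flow generated by $Y_i$ and consider the orbit $$y(p)=G_1(t_1)\circ\dots\circ G_M(t_M)(x_0),\qquad p=(t_1,\dots,t_M)\in D_M=\prod_{i=1}^M(-a_i,a_i).$$ Put $H_i(t;y)=\left[\frac{\partial G_i}{\partial y}(t;y)\right]^{-1}$, $y_1=y$, $y_{i+1}=G_i(-t_i;y_i)$ for $i\in\{1,\dots,M-1\}$, and define $$X_{j}(t_1,\dots,t_{j-1};y)=H_1(-t_1;y_1)H_2(-t_2;y_2)\cdots H_{j-1}(-t_{j-1};y_{j-1})\,Y_j(y_j),\qquad j=2,\dots,M.$$ Then there exist a ball $B(0,\alpha)\subseteq\mathbb{R}^M$ and a nonsingular $M\times M$ matrix $A(p)=(a_{ij}(p))_{i,j\in\{1,\dots,M\}}$, $a_{ij}\in\mathcal{C}^\infty(B(0,\alpha))$, such that $$\{Y_1(\cdot),X_2(t_1;\cdot),\dots,X_M(t_1,\dots,t_{M-1};\cdot)\}(y(p))=\{Y_1(\cdot),Y_2(\cdot),\dots,Y_M(\cdot)\}(y(p))\,A(p)$$ for any $p\in B(0,\alpha)$, and $A(0)=I_M$.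
   Context: $L(g_1,\dots,g_m)$ is the smallest real Lie algebra of vector fields in $\mathcal{C}^\infty(\mathbb{R}^n;\mathbb{R}^n)$ containing $g_1,\dots,g_m$, where the product is the Lie bracket $[X,Y]=\frac{\partial Y}{\partial x}X-\frac{\partial X}{\partial x}Y$. For a Lie algebra $\Lambda\subseteq\mathcal{C}^\infty(\mathbb{R}^n;\mathbb{R}^n)$, an orbit of origin $x_0$ of $\Lambda$ is a finite composition of local flows $G(p,x_0)=G_1(t_1)\circ\dots\circ G_k(t_k)(x_0)$, $p=(t_1,\dots,t_k)\in D_k$ ($D_k$ a box $\prod_1^k(-a_i,a_i)$ around $0$ on which the composition is defined), where each $G_i$ is the local flow generated by some element of $\Lambda$. $\Lambda$ is finitely generated with respect to orbits of origin $x_0$ (abbreviated $(f.g.o;x_0)$) if there exist $Y_1,\dots,Y_M\in\Lambda$ (a ''system of generators'') such that for any $Y\in\Lambda$ and any orbit $G(p,x_0)$, $p\in D_k$, one has $Y(G(p,x_0))=\sum_{j=1}^M a_j(p)Y_j(G(p,x_0))$ with $a_j\in\mathcal{C}^\infty(D_k;\mathbb{R})$ depending on $Y$ and on the orbit. A bracketed list $\{Z_1,\dots,Z_M\}(y)$ denotes the $n\times M$ matrix with columns $Z_1(y),\dots,Z_M(y)$. The numbers $a_i>0$ are taken small enough for all the flows to be defined. *)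

(* Defs.v *)
From HB Require Import structures.
From mathcomp Require Import all_boot all_order all_algebra.
From mathcomp Require Import all_classical all_reals all_analysis.

Set Implicit Arguments.
Unset Strict Implicit.
Unset Printing Implicit Defensive.
Import Order.TTheory GRing.Theory Num.Theory.
Import numFieldNormedType.Exports.

Local Open Scope classical_set_scope.
Local Open Scope ring_scope.

(* Meant for open D and finite-dimensional V: quantifying over all directions v
   then amounts to iterating all partial derivatives. *)
Fixpoint Ck_on (R : realType) (V W : normedModType R) (k : nat) (D : set V)
    (f : V -> W) : Prop :=
  if k is k'.+1 then
    (forall x, D x -> differentiable f x) /\
    (forall v : V, Ck_on k' D ('D_v f))
  else forall x, D x -> {for x, continuous f}.

Definition smooth_on (R : realType) (V W : normedModType R) (D : set V)
    (f : V -> W) : Prop :=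
  forall k : nat, Ck_on k D f.

Definition jac (R : realType) (m n : nat) (f : 'cV[R]_n -> 'cV[R]_m)
    (x : 'cV[R]_n) : 'M[R]_(m, n) :=
  \matrix_(i < m, j < n) ('D_(delta_mx j 0) f x) i 0.

Definition lie_bracket (R : realType) (n : nat) (X Y : 'cV[R]_n -> 'cV[R]_n) :
    'cV[R]_n -> 'cV[R]_n :=
  fun x => jac Y x *m X x - jac X x *m Y x.

Definition lie_algebra (R : realType) (n : nat)
    (A : set ('cV[R]_n -> 'cV[R]_n)) : Prop :=
  [/\ forall X, A X -> smooth_on setT X,
      A (fun=> 0),
      forall X Y, A X -> A Y -> A (fun x => X x + Y x),
      forall (c : R) X, A X -> A (fun x => c *: X x)
    & forall X Y, A X -> A Y -> A (lie_bracket X Y)].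

Definition gen_lie (R : realType) (n m : nat)
    (g : 'I_m -> 'cV[R]_n -> 'cV[R]_n) : set ('cV[R]_n -> 'cV[R]_n) :=
  smallest (@lie_algebra R n) (range g).

(* [G t x] is meaningful only for [(t, x)] in the flow domain [D], which may be
   (-a, a) x U for a neighbourhood U, or the maximal one. Smoothness of G on D
   follows from that of Y and is not required. *)
Definition local_flow (R : realType) (n : nat) (Y : 'cV[R]_n -> 'cV[R]_n)
    (D : set (R * 'cV[R]_n)) (G : R -> 'cV[R]_n -> 'cV[R]_n) : Prop :=
  [/\ open D,
      forall t x, D (t, x) -> forall r : R, 0 <= r <= 1 -> D (r * t, x),
      forall x, D (0, x) -> G 0 x = x
    & forall t x, D (t, x) -> is_derive t 1 (fun s : R => G s x) (Y (G t x))].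

Definition box (R : realType) (k : nat) (a : 'I_k -> R) : set 'rV[R]_k :=
  [set p | forall i, - a i < p 0 i < a i].

(* Indices start at 0: [orbit_from G x0 p i] is
   G_i(t_i) o ... o G_{k-1}(t_{k-1}) (x0), and equals x0 for i = k. *)
Definition orbit_from (R : realType) (n k : nat)
    (G : 'I_k -> R -> 'cV[R]_n -> 'cV[R]_n) (x0 : 'cV[R]_n)
    (p : 'rV[R]_k) (i : nat) : 'cV[R]_n :=
  foldr (fun j y => G j (p 0 j) y) x0 (drop i (enum 'I_k)).

Definition orbit_pt (R : realType) (n k : nat)
    (G : 'I_k -> R -> 'cV[R]_n -> 'cV[R]_n) (x0 : 'cV[R]_n) (p : 'rV[R]_k) :=
  orbit_from G x0 p 0.

Definition orbit_defined (R : realType) (n k : nat)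
    (D : 'I_k -> set (R * 'cV[R]_n)) (G : 'I_k -> R -> 'cV[R]_n -> 'cV[R]_n)
    (x0 : 'cV[R]_n) (a : 'I_k -> R) : Prop :=
  (forall i, 0 < a i) /\
  forall p, box a p -> forall i : 'I_k, D i (p 0 i, orbit_from G x0 p i.+1).

Definition generators (R : realType) (n M : nat)
    (A : set ('cV[R]_n -> 'cV[R]_n)) (x0 : 'cV[R]_n)
    (Y : 'I_M -> 'cV[R]_n -> 'cV[R]_n) : Prop :=
  (forall j, A (Y j)) /\
  forall (Z : 'cV[R]_n -> 'cV[R]_n), A Z ->
  forall (k : nat) (V : 'I_k -> 'cV[R]_n -> 'cV[R]_n)
    (D : 'I_k -> set (R * 'cV[R]_n)) (G : 'I_k -> R -> 'cV[R]_n -> 'cV[R]_n)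
    (a : 'I_k -> R),
  (forall i, A (V i)) -> (forall i, local_flow (V i) (D i) (G i)) ->
  orbit_defined D G x0 a ->
  exists c : 'I_M -> 'rV[R]_k -> R,
    (forall j, smooth_on (box a) (c j)) /\
    forall p, box a p ->
      Z (orbit_pt G x0 p) = \sum_(j < M) c j p *: Y j (orbit_pt G x0 p).

Definition fgo (R : realType) (n : nat)
    (A : set ('cV[R]_n -> 'cV[R]_n)) (x0 : 'cV[R]_n) : Prop :=
  exists (M : nat) (Y : 'I_M -> 'cV[R]_n -> 'cV[R]_n), generators A x0 Y.

Definition flow_Hinv (R : realType) (n : nat)
    (G : R -> 'cV[R]_n -> 'cV[R]_n) (t : R) (y : 'cV[R]_n) : 'M[R]_n :=
  invmx (jac (G t) y).

(* With indices from 0: y_0 = y and y_{i+1} = G_i(-t_i; y_i). *)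
Definition back_pt (R : realType) (n M : nat)
    (G : 'I_M -> R -> 'cV[R]_n -> 'cV[R]_n) (p : 'rV[R]_M) (y : 'cV[R]_n)
    (i : nat) : 'cV[R]_n :=
  foldl (fun z j => G j (- p 0 j) z) y (take i (enum 'I_M)).

(* The product is taken in increasing order of i; for j = 0 it is empty, so
   that the first field is Y_0. *)
Definition transported (R : realType) (n M : nat)
    (Y : 'I_M -> 'cV[R]_n -> 'cV[R]_n) (G : 'I_M -> R -> 'cV[R]_n -> 'cV[R]_n)
    (j : 'I_M) (p : 'rV[R]_M) (y : 'cV[R]_n) : 'cV[R]_n :=
  (\big[mulmx/1%:M]_(i < M | (i < j)%N)
      flow_Hinv (G i) (- p 0 i) (back_pt G p y i))
  *m Y j (back_pt G p y j).

Definition cols (R : realType) (n M : nat) (Z : 'I_M -> 'cV[R]_n -> 'cV[R]_n)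
    (y : 'cV[R]_n) : 'M[R]_(n, M) :=
  \matrix_(i < n, j < M) Z j y i 0.

(* Main.v *)
(* Along c(s) = G_i(-s t_i; y_i), 0 <= s <= 1, the n x M matrix {Y}(c(s)) satisfies
   U' = -t_i (DY_i)(c) U + U C, where the coefficients C are smooth in p: this is
   what finite generation on the orbit gives for the brackets [Y_i, Y_j], because
   c(s) is the value of the orbit map at p with t_1, ..., t_{i-1} replaced by 0 and
   t_i by (1 - s) t_i.  If J is the Jacobian of the flow (J' = -t_i (DY_i)(c) J) and
   Psi solves Psi' = Psi C, Psi(0) = I, then U(s) = J(s) U(0) Psi(s) by uniqueness,
   so that H_i(-t_i; y_i) {Y}(y_{i+1}) = {Y}(y_i) Psi_i(p).  Hence the j-th column of
   A(p) is the j-th column of Psi_1(p) ... Psi_{j-1}(p).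

   The flows are only assumed to solve their equation in t; first-order
   differentiability in the initial point, near x_0, comes from Gronwall's inequality.
   Smoothness of Psi_i in p follows from one fact, continuous dependence of linear
   equations on parameters: a solution and its difference quotient in p together solve
   a linear equation with block triangular coefficients, which has a limit as the
   increment tends to 0. *)
From HB Require Import structures.
Require Import Defs.
From mathcomp Require Import all_boot all_order all_algebra.
From mathcomp Require Import all_classical all_reals all_analysis.
From mathcomp Require Import ring lra.
Set Implicit Arguments.
Unset Strict Implicit.
Unset Printing Implicit Defensive.
Import Order.TTheory GRing.Theory Num.Theory.
Import numFieldNormedType.Exports.
Local Open Scope classical_set_scope.
Local Open Scope ring_scope.

(** * Matrix-valued functions of a real variable *)

Section MatrixFunctions.
Variable R : realType.

(** Neither the flows nor the curves c(s) are shown to be smooth in p: p enters Psi_i only through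
    C, whose entries finite generation makes smooth functions of a point that is linear in p. In s
    only continuity is asked, because the equations live on [0, 1] and are extended to the line by a
    clamp, which is not differentiable. Hence the families [f s p], of class C^k in p and jointly
    continuous in (s, p) together with their derivatives.

    The unknowns are rows multiplied on the right by the coefficient: Psi' = Psi C then splits into
    independent rows, and differentiating in p only doubles the length of a row.

    A is not a product of the Psi_i, since each column stops at a different factor. Its
    nonsingularity therefore comes from A(0) = I and continuity of the determinant, at the price of
    a smaller ball. *)

Lemma is_derive_mxP (V : normedModType R) m n (u : V -> 'M[R]_(m, n)) x v du :
  is_derive x v u du <->
  forall i j, is_derive x v (fun y => u y i j) (du i j).
Proof.
split=> [[ud <-] i j|ud].
  split; first exact: (derivable_mxP u x v).1 ud i j.
  by rewrite derive_mx // mxE.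
have dud : derivable u x v.
  by apply/derivable_mxP => i j; case: (ud i j).
split=> //; rewrite derive_mx //; apply/matrixP => i j.
by rewrite mxE; case: (ud i j).
Qed.

Lemma mx_norm_coord m n (A : 'M[R]_(m, n)) i j : `|A i j| <= `|A|.
Proof.
rewrite [leRHS]/Num.Def.normr/= mx_normrE.
exact: (le_bigmax _ (fun ij => `|A ij.1 ij.2|) (i, j)).
Qed.

Lemma mx_norm_le m n (A : 'M[R]_(m, n)) e :
  0 <= e -> (forall i j, `|A i j| <= e) -> `|A| <= e.
Proof.
move=> e0 Ae; rewrite [leLHS]/Num.Def.normr/= mx_normrE.
by apply: bigmax_le => // -[i j] _; exact: Ae.
Qed.

Lemma mx_norm_lt m n (A : 'M[R]_(m, n)) e :
  0 < e -> (forall i j, `|A i j| < e) -> `|A| < e.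
Proof.
move=> e0 Ae; rewrite [ltLHS]/Num.Def.normr/= mx_normrE.
by apply: bigmax_lt => // -[i j] _; exact: Ae.
Qed.

Lemma mx_norm_mul m n p (A : 'M[R]_(m, n)) (B : 'M[R]_(n, p)) :
  `|A *m B| <= n%:R * `|A| * `|B|.
Proof.
apply: mx_norm_le => [|i j]; first by rewrite !mulr_ge0.
rewrite mxE; apply: le_trans (ler_norm_sum _ _ _) _.
have -> : n%:R * `|A| * `|B| = \sum_(k < n) `|A| * `|B|.
  by rewrite sumr_const card_ord -[RHS]mulr_natl mulrA.
apply: ler_sum => k _; rewrite normrM.
by apply: ler_pM => //; exact: mx_norm_coord.
Qed.

Lemma continuous_mxP (T : topologicalType) m n (u : T -> 'M[R]_(m, n)) x :
  {for x, continuous u} <->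
  forall i j, {for x, continuous (fun y => u y i j)}.
Proof.
split=> [uc i j|uc].
  exact: (continuous_comp uc (@coord_continuous _ _ _ i j _)).
apply/cvgrPdist_lt => e e0.
have /= near_ij : \forall y \near x, forall ij, `|u x ij.1 ij.2 - u y ij.1 ij.2| < e.
  apply: filter_forall => -[i j] /=.
  by have /cvgrPdist_lt := uc i j; apply.
apply: filterS near_ij => y yx.
by apply: mx_norm_lt => // i j; rewrite !mxE; exact: (yx (i, j)).
Qed.

Lemma continuous_sum (T : topologicalType) (I : Type) (r : seq I)
    (F : I -> T -> R) x :
  (forall i, {for x, continuous (F i)}) ->
  {for x, continuous (fun y => \sum_(i <- r) F i y)}.
Proof.
by move=> Fc; apply: cvg_big => [|i _]; [exact: add_continuous|exact: Fc].
Qed.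

Lemma continuous_mulmx (T : topologicalType) m n p (A : T -> 'M[R]_(m, n))
    (B : T -> 'M[R]_(n, p)) x :
  {for x, continuous A} -> {for x, continuous B} ->
  {for x, continuous (fun y => A y *m B y)}.
Proof.
move=> /continuous_mxP Ac /continuous_mxP Bc; apply/continuous_mxP => i j.
rewrite [X in {for _, continuous X}](_ : _ =
  fun y => \sum_k A y i k * B y k j); last by apply/funext => y; rewrite mxE.
by apply: continuous_sum => k; apply: cvgM; [exact: Ac|exact: Bc].
Qed.

Lemma is_derive_mulmx m n p (A : R -> 'M[R]_(m, n)) (B : R -> 'M[R]_(n, p))
    (s : R) dA dB :
  is_derive s 1 A dA -> is_derive s 1 B dB ->
  is_derive s 1 (fun t => A t *m B t) (dA *m B s + A s *m dB).
Proof.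
move=> /is_derive_mxP dA' /is_derive_mxP dB'; apply/is_derive_mxP => i j.
rewrite [X in is_derive _ _ X](_ : _ =
  \sum_k (fun t => A t i k) * (fun t => B t k j)); last first.
  by apply/funext => t; rewrite mxE fct_sumE.
apply: is_derive_eq.
rewrite !mxE -big_split; apply: eq_bigr => k _ /=.
by rewrite [RHS]addrC; congr (_ + _); rewrite /GRing.scale/= mulrC.
Qed.

Lemma is_derive_trmx a b (X : R -> 'M[R]_(a, b)) (s : R) dX :
  is_derive s 1 X dX -> is_derive s 1 (fun t => (X t)^T) dX^T.
Proof.
move=> /is_derive_mxP Xd; apply/is_derive_mxP => i j.
rewrite (_ : (fun _ => _) = (fun t => X t j i)) ?mxE //.
by apply/funext => t; rewrite mxE.
Qed.

Lemma continuous_trmx a b (X : R -> 'M[R]_(a, b)) (s : R) :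
  {for s, continuous X} -> {for s, continuous (fun t => (X t)^T)}.
Proof.
move=> /continuous_mxP Xc; apply/continuous_mxP => i j.
rewrite (_ : (fun _ => _) = (fun t => X t j i)) //.
by apply/funext => t; rewrite mxE.
Qed.

Lemma is_derive1_continuous (V : normedModType R) (u : R -> V) (s : R) du :
  is_derive s 1 u du -> {for s, continuous u}.
Proof.
by case=> ud _; apply/differentiable_continuous/derivable1_diffP.
Qed.

Lemma is_derive_comp1 (V W : normedModType R) (f : V -> W) (c : R -> V)
    (s : R) dc :
  is_derive s 1 c dc -> differentiable f (c s) ->
  is_derive s 1 (f \o c) ('D_dc f (c s)).
Proof.
move=> [cd <-] fd; have cd' := (derivable1_diffP c s).1 cd.
have fcd : differentiable (f \o c) s by exact: differentiable_comp.
split; first exact/derivable1_diffP.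
by rewrite !deriveE // diff_comp.
Qed.

Lemma is_derive_scale_arg (V : normedModType R) (u : R -> V) (a s : R) du :
  is_derive (a * s) 1 u du ->
  is_derive s 1 (fun r => u (a * r)) (a *: du).
Proof.
move=> [ud <-].
have ad : is_derive s 1 (fun r : R => a * r) a.
  by apply: is_derive_eq; rewrite /GRing.scale/= mulr1.
have ud' := (derivable1_diffP u (a * s)).1 ud.
have [h1 h2] := is_derive_comp1 ad ud'.
split=> //; rewrite h2 !deriveE // -linearZ /=; congr ('d u _ _).
by rewrite /GRing.scale/= mulr1.
Qed.

(** The norm is the largest entry, so each signed entry is compared with [b] by the scalar mean
    value theorem. A varying bound [b] is needed for the exponential weight in the Picard
    iteration. *)
Lemma mean_value_mx_le m n (u du : R -> 'M[R]_(m, n)) (b db : R -> R)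
    (lo hi : R) :
  lo <= hi -> (forall s : R, lo <= s <= hi -> is_derive s 1 u (du s)) ->
  (forall s : R, lo <= s <= hi -> is_derive s 1 b (db s)) ->
  (forall s, lo < s < hi -> `|du s| <= db s) -> `|u hi - u lo| <= b hi - b lo.
Proof.
rewrite le_eqVlt => /predU1P[<- _ _ _|lohi ud bd dub].
  by rewrite !subrr normr0.
have mvt (f df : R -> R) : (forall s : R, lo <= s <= hi -> is_derive s 1 f (df s)) ->
    (forall s, lo < s < hi -> 0 <= df s) -> 0 <= f hi - f lo.
  move=> fd df0; have [s||s] := MVT lohi (_ : forall x, x \in `]lo, hi[ -> is_derive x 1 f (df x)).
  - by rewrite in_itv/= => /andP[? ?]; apply: fd; rewrite !ltW.
  - apply: derivable_within_continuous => s; rewrite in_itv/= => slh.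
    by case: (fd s slh).
  - move=> /[!in_itv]/= slh ->; rewrite mulr_ge0 ?subr_ge0 ?(ltW lohi) //.
    exact: df0.
have signed (sg : R) i j : sg ^+ 2 = 1 ->
    sg * (u hi - u lo) i j <= b hi - b lo.
  move=> sg1; pose f t := b t - sg * u t i j.
  suff : 0 <= f hi - f lo by rewrite /f !mxE; lra.
  apply: (mvt _ (fun s => db s - sg * du s i j)) => s slh.
    have bds := bd s slh.
    have /is_derive_mxP/(_ i j) uds := ud s slh.
    by apply: is_derive_eq; rewrite /GRing.scale/=; ring.
  rewrite subr_ge0; apply: le_trans (dub s slh).
  apply: le_trans (mx_norm_coord _ i j).
  have -> : `|du s i j| = `|sg * du s i j|.
    rewrite normrM; suff -> : `|sg| = 1 by rewrite mul1r.
    by apply/eqP; rewrite -(@eqrXn2 _ 2) ?ler01// real_normK ?num_real// sg1 expr1n.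
  exact: ler_norm.
have b0 : 0 <= b hi - b lo.
  by apply: (mvt _ db) => // s slh; exact: le_trans (dub s slh).
apply: mx_norm_le => // i j; rewrite ler_norml; apply/andP; split.
  by have := signed (-1) i j; rewrite sqrrN expr1n mulN1r => /(_ erefl); lra.
by have := signed 1 i j; rewrite expr1n mul1r; apply.
Qed.

Lemma mean_value_mx m n (u du : R -> 'M[R]_(m, n)) (lo hi B : R) :
  lo <= hi -> (forall s : R, lo <= s <= hi -> is_derive s 1 u (du s)) ->
  (forall s, lo < s < hi -> `|du s| <= B) -> `|u hi - u lo| <= B * (hi - lo).
Proof.
move=> lohi ud duB; rewrite mulrBr.
apply: (@mean_value_mx_le _ _ u du ( *%R B) (fun=> B)) => // s _.
by apply: is_derive_eq; rewrite /GRing.scale/= mulr1.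
Qed.

(* The differential inequality is applied to the smooth function
   [(\sum u_ij^2 + e^2) * exp (- l s)] rather than to [`|u|]. *)
Lemma gronwall m n (L : R) : 0 <= L -> exists2 K : R, 0 < K &
  forall (u du : R -> 'M[R]_(m, n)) (e : R), 0 <= e -> `|u 0| <= e ->
    (forall s : R, 0 <= s <= 1 -> is_derive s 1 u (du s)) ->
    (forall s, 0 <= s <= 1 -> `|du s| <= L * `|u s| + e) ->
    forall s : R, 0 <= s <= 1 -> `|u s| <= K * e.
Proof.
move=> L0; pose d : R := (m * n)%:R; have d0 : 0 <= d by [].
(* From 2uv <= u^2 + v^2 in each of the [d] entries and |u'|^2 <= 2 (L^2 |u|^2 + e^2), so that
   [dE t <= l * (E t + e ^+ 2)]. *)
pose l := 1 + d * 2 * (L ^+ 2 + 1).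
have l0 : 0 <= l by rewrite addr_ge0 // !mulr_ge0 // addr_ge0 // sqr_ge0.
have el1 : 1 <= expR l by rewrite -expR0 ler_expR.
(* The square root of this number would do; as it is at least 1, it is itself a valid constant and
   no root is taken. *)
exists ((d + 1) * expR l); first by rewrite mulr_gt0 ?expR_gt0 // ltr_wpDl.
move=> u du e e0 u0 ud due s s01.
pose E t := \sum_(ij : 'I_m * 'I_n) u t ij.1 ij.2 ^+ 2.
pose dE t := \sum_(ij : 'I_m * 'I_n) 2 * u t ij.1 ij.2 * du t ij.1 ij.2.
have sumd (c : R) : \sum_(ij : 'I_m * 'I_n) c = d * c.
  by rewrite sumr_const card_prod !card_ord /d mulr_natl.
have E0 t : 0 <= E t by apply: sumr_ge0 => ij _; exact: sqr_ge0.
have uE t : `|u t| ^+ 2 <= E t.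
  rewrite -[leRHS]sqr_sqrtr // ler_sqr ?nnegrE ?sqrtr_ge0 //.
  apply: mx_norm_le => [|i j]; first exact: sqrtr_ge0.
  rewrite -ler_sqr ?nnegrE ?sqrtr_ge0 // sqr_sqrtr // real_normK ?num_real //.
  rewrite /E (bigD1 (i, j)) //= lerDl.
  by apply: sumr_ge0 => ij _; exact: sqr_ge0.
have dEl (t : R) : 0 <= t <= 1 -> dE t <= l * (E t + e ^+ 2).
  move=> t01.
  apply: (@le_trans _ _ (\sum_(ij : 'I_m * 'I_n)
      (u t ij.1 ij.2 ^+ 2 + `|du t| ^+ 2))).
    apply: ler_sum => -[i j] _ /=.
    have : du t i j ^+ 2 <= `|du t| ^+ 2.
      rewrite -real_normK ?num_real // ler_sqr ?nnegrE //.
      exact: mx_norm_coord.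
    have := sqr_ge0 (u t i j - du t i j); nra.
  rewrite big_split /= -/(E t) sumd.
  have : `|du t| ^+ 2 <= 2 * (L ^+ 2 * E t + e ^+ 2).
    have h1 : `|du t| ^+ 2 <= (L * `|u t| + e) ^+ 2.
      by rewrite ler_sqr ?nnegrE ?addr_ge0 ?mulr_ge0 //; exact: due.
    have := uE t; have := sqr_ge0 (L * `|u t| - e); have := sqr_ge0 L; nra.
  move=> h; have {}h := ler_wpM2l d0 h.
  have h1 : 0 <= d * E t by rewrite mulr_ge0.
  have h2 : 0 <= d * (L ^+ 2 * e ^+ 2) by rewrite !mulr_ge0 ?sqr_ge0.
  have := sqr_ge0 e; rewrite /l; nra.
pose phi t := (E t + e ^+ 2) * expR (- l * t).
have Ed (t : R) : 0 <= t <= 1 -> is_derive t 1 E (dE t).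
  move=> t01; rewrite [E](_ : _ = \sum_(ij : 'I_m * 'I_n)
      (fun t => u t ij.1 ij.2) ^+ 2); last first.
    by apply/funext => r; rewrite fct_sumE; apply: eq_bigr.
  rewrite /dE; elim/big_ind2 : _ => [|f df g dg|[i j] _ /=].
  - exact: is_derive_cst.
  - exact: is_deriveD.
  - have /is_derive_mxP/(_ i j) := ud t t01 => uij.
    by apply: is_derive_eq; rewrite /= expr1.
have phid (t : R) : 0 <= t <= 1 ->
    is_derive t 1 phi ((dE t - l * (E t + e ^+ 2)) * expR (- l * t)).
  move=> t01; have Edt := Ed t t01.
  have h : is_derive t 1 (fun r : R => expR (- l * r)) (- l * expR (- l * t)).
    exact: is_derive_scale_arg.
  apply: is_derive_eq; rewrite /GRing.scale/= addr0.
  by ring.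
have : phi s <= phi 0.
  have [s0 s1] := andP s01.
  apply: (@ler0_derive1_le_cc _ phi 0 s).
  - by move=> t; rewrite in_itv/= => /andP[t0 ts]; case: (phid t _); first lra.
  - move=> t; rewrite in_itv/= => /andP[t0 ts].
    have t01 : 0 <= t <= 1 by lra.
    rewrite derive1E; have [_ ->] := phid t t01.
    by rewrite mulr_le0_ge0 ?expR_ge0 // subr_le0 dEl.
  - by apply: derivable_within_continuous => t; rewrite in_itv/= => h;
      case: (phid t _); first lra.
  - by rewrite in_itv/= ?lexx ?s0.
  - by rewrite in_itv/= ?lexx ?s0.
  - by [].
rewrite /phi mulr0 expR0 mulr1 => phis.
have E0e : E 0 <= d * e ^+ 2.
  rewrite -sumd; apply: ler_sum => -[i j] _ /=.
  rewrite -real_normK ?num_real // ler_sqr ?nnegrE //.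
  exact: le_trans (mx_norm_coord _ _ _) u0.
have h : (E s + e ^+ 2) <= (E 0 + e ^+ 2) * expR l.
  have {}phis := ler_wpM2r (expR_ge0 (l * s)) phis.
  rewrite -mulrA -expRD mulNr addNr expR0 mulr1 in phis.
  apply: le_trans phis _; rewrite ler_wpM2l ?addr_ge0 ?sqr_ge0 //.
  by rewrite ler_expR ler_piMr //; lra.
have hh : `|u s| ^+ 2 <= (d + 1) * expR l * e ^+ 2.
  apply: le_trans (uE s) _.
  have := sqr_ge0 e; nra.
rewrite -ler_sqr ?nnegrE //; last by rewrite !mulr_ge0 ?addr_ge0 ?expR_ge0.
apply: le_trans hh _; rewrite exprMn ler_wpM2r ?sqr_ge0 //.
by rewrite expr2 ler_peMr ?mulr_ge0 ?addr_ge0 ?expR_ge0 // mulr_ege1 // lerDr.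
Qed.

End MatrixFunctions.

(** * Linear differential equations *)

Section LinearODE.
Variable R : realType.

(** The nearest point of [0, 1], written with absolute values so that continuity is immediate. It
    extends functions controlled only on [0, 1] to the whole line. *)
Definition clamp01 (s : R) : R := (`|s| - `|s - 1| + 1) / 2.

Lemma clamp01_itv s : 0 <= clamp01 s <= 1.
Proof.
rewrite /clamp01; have [s0|s0] := ger0P s; have [s1|s1] := ger0P (s - 1); lra.
Qed.

Lemma clamp01_id s : 0 <= s <= 1 -> clamp01 s = s.
Proof.
move=> /andP[s0 s1]; rewrite /clamp01 ger0_norm // ler0_norm ?subr_le0 //; lra.
Qed.

Lemma continuous_clamp01 : continuous clamp01.
Proof.
move=> s; apply: cvgM; last exact: cvg_cst.
apply: cvgD; last exact: cvg_cst.
apply: cvgB; first exact: norm_continuous.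
apply: (@continuous_comp _ _ _ (fun r : R => r - 1) (@Num.norm _ R)); last exact: norm_continuous.
by apply: cvgB; [exact: cvg_id|exact: cvg_cst].
Qed.

Lemma antiderivative (f : R -> R) : continuous f ->
  exists2 F : R -> R, F 0 = 0 &
  forall s : R, 0 <= s <= 1 -> is_derive s 1 F (f s).
Proof.
move=> fc.
(* Starting at -1, and applying the fundamental theorem on an interval that ends at 2, makes 0 and 1
   interior points: the derivative is two-sided at both. *)
pose F (x : R) : R := (\int[lebesgue_measure]_(t in `[(-1)%R, x]) f t)%R.
exists (fun x => F x - F 0); first by rewrite subrr.
move=> s s01.
have [Fd Fe] : derivable F s 1 /\ F^`()%classic s = f s.
  apply: (@continuous_FTC1_closed _ f (-1) s 2); [lra| |lra|exact: fc].
  apply: continuous_compact_integrable; first exact: segment_compact.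
  exact: continuous_subspaceT.
rewrite derive1E in Fe.
have Fd' : is_derive s 1 F (f s) by split.
by apply: is_derive_eq; rewrite subr0.
Qed.

Lemma antiderivative_mx m n (f : R -> 'M[R]_(m, n)) (e : 'M[R]_(m, n)) :
  continuous f -> exists2 F : R -> 'M[R]_(m, n), F 0 = e &
  forall s : R, 0 <= s <= 1 -> is_derive s 1 F (f s).
Proof.
move=> fc.
have /choice[F HF] : forall ij : 'I_m * 'I_n, exists F : R -> R, F 0 = 0 /\
  forall s : R, 0 <= s <= 1 -> is_derive s 1 F (f s ij.1 ij.2).
  move=> [i j]; have [|F F0 Fd] := @antiderivative (fun s => f s i j).
    by move=> s; have /continuous_mxP := fc s; apply.
  by exists F.
exists (fun s => e + \matrix_(i, j) F (i, j) s).
  by apply/matrixP => i j; rewrite !mxE (HF _).1 addr0.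
move=> s s01; apply/is_derive_mxP => i j.
have := (HF (i, j)).2 s s01 => /= Fd.
rewrite (_ : (fun _ => _) = cst (e i j) + F (i, j)); last first.
  by apply/funext => t; rewrite !mxE.
by apply: is_derive_eq; rewrite add0r.
Qed.

(** The telescoping series converges absolutely; the explicit rate is kept because the Picard limit
    must be uniform in time. *)
Lemma geometric_steps_cvg (v : nat -> R) c : 0 <= c ->
  (forall k, `|v k.+1 - v k| <= c * 2^-1 ^+ k) ->
  exists l, forall k, `|l - v k| <= 2 * c * 2^-1 ^+ k.
Proof.
move=> c0 vc.
(* The factor [1 - 2^-1 ^+ d] is the exact geometric sum, which lets the induction on [d] close. *)
have vm k d : `|v (k + d)%N - v k| <= 2 * c * 2^-1 ^+ k * (1 - 2^-1 ^+ d).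
  elim: d => [|d IH]; first by rewrite addn0 expr0 !subrr normr0 mulr0.
  have -> : v (k + d.+1)%N - v k = (v (k + d).+1 - v (k + d)%N) + (v (k + d)%N - v k).
    by rewrite addnS; ring.
  apply: le_trans (ler_normD _ _) _.
  apply: le_trans (lerD (vc _) IH) _.
  rewrite exprD exprSr.
  set x := 2^-1 ^+ k; set y := 2^-1 ^+ d; lra.
have cv : cvg (v @ \oo).
  have -> : v = (fun n => v 0%N + series (telescope v) n).
    by apply/funext => n; rewrite -eq_sum_telescope.
  apply: is_cvgD; first exact: is_cvg_cst.
  apply: normed_cvg.
  apply: (@series_le_cvg _ _ (geometric c 2^-1)) => //.
  - by move=> n; exact: normr_ge0.
  - by move=> n; rewrite /geometric /= mulr_ge0 // exprn_ge0.
  - by apply: is_cvg_geometric_series; rewrite ger0_norm // invf_lt1 // ltr1n.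
exists (lim (v @ \oo)) => k.
apply/ler_addgt0Pr => e e0.
have /cvgrPdist_lt/(_ e e0)[N _ HN] := cv.
have /= h1 := HN (k + N)%N (leq_addl _ _).
have h2 := vm k N.
have h3 : 2 * c * 2^-1 ^+ k * (1 - 2^-1 ^+ N) <= 2 * c * 2^-1 ^+ k.
  rewrite ler_piMr ?mulr_ge0 // ?exprn_ge0 // lerBlDr lerDl exprn_ge0 //.
have -> : lim (v @ \oo) - v k = (lim (v @ \oo) - v (k + N)%N) + (v (k + N)%N - v k).
  by ring.
apply: le_trans (ler_normD _ _) _.
by rewrite [leRHS]addrC; exact: lerD (ltW h1) (le_trans h2 h3).
Qed.

Lemma bounded01 m n (u : R -> 'M[R]_(m, n)) :
  (forall s : R, 0 <= s <= 1 -> {for s, continuous u}) ->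
  exists2 L, 0 <= L & forall s, 0 <= s <= 1 -> `|u s| <= L.
Proof.
move=> uc; have [|L _ HL] := @EVT_max _ (fun s => `|u s|) 0 1 ler01.
  apply: continuous_in_subspaceT => s; rewrite inE/= in_itv/= => s01.
  apply: continuous_comp; first exact: uc.
  exact: norm_continuous.
exists `|u L| => // s s01; by apply: HL; rewrite in_itv.
Qed.

(** Picard iteration. Measured against the weight [expR (l * s)], each step contracts by 1/2 on the
    whole of [0, 1], so no short intervals have to be glued. *)
Lemma linear_ode_exists N (C : R -> 'M[R]_N) (e : 'rV[R]_N) :
  continuous C -> exists2 x : R -> 'rV[R]_N, x 0 = e &
  forall s : R, 0 <= s <= 1 -> is_derive s 1 x (x s *m C s).
Proof.
move=> Cc.
pose cont01 (x : R -> 'rV[R]_N) :=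
  forall s : R, 0 <= s <= 1 -> {for s, continuous x}.
have comp_clamp x : cont01 x -> continuous (x \o clamp01).
  move=> xc s; apply: continuous_comp; first exact: continuous_clamp01.
  exact/xc/clamp01_itv.
(* [T] is the Picard operator, specified only on functions continuous on [0, 1]; its values are
   again of this kind. *)
have /choice[T HT] : forall x : R -> 'rV[R]_N, exists y : R -> 'rV[R]_N,
    cont01 x -> [/\ y 0 = e, cont01 y &
      forall s : R, 0 <= s <= 1 -> is_derive s 1 y (x s *m C s)].
  move=> x; have [xc|nxc] := pselect (cont01 x); last by exists x => /nxc.
  have [s|y y0 yd] := @antiderivative_mx _ _ (fun s => x (clamp01 s) *m C s) e.
    by apply: continuous_mulmx; [exact: (comp_clamp _ xc)|exact: Cc].
  exists y => _.
  have yd' (s : R) : 0 <= s <= 1 -> is_derive s 1 y (x s *m C s).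
    by move=> s01; have := yd s s01; rewrite clamp01_id.
  by split=> // s /yd'; exact: is_derive1_continuous.
have [L L0 CL] := @bounded01 _ _ C (fun s _ => Cc s).
(* Integrating the weight gains a factor 1 / l, while multiplication by [C] costs at most
   [N%:R * L]; this [l] makes the balance at most 1/2. *)
pose l := 2 * (N%:R * L + 1); have NL0 : 0 <= N%:R * L by rewrite mulr_ge0.
have l0 : 0 < l by rewrite /l; lra.
pose x k := iter k T (fun=> e).
have xc k : cont01 (x k).
  elim: k => [|k IH]; first by move=> s _; exact: cst_continuous.
  by have [] := HT _ IH.
have xd k (s : R) : 0 <= s <= 1 -> is_derive s 1 (x k.+1) (x k s *m C s).
  by have [_ _] := HT _ (xc k); apply.
have x0 k : x k 0 = e by case: k => // k; have [] := HT _ (xc k).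
have [c c0 xc01] : exists2 c, 0 <= c & forall s, 0 <= s <= 1 -> `|x 1%N s - x 0%N s| <= c.
  apply: (@bounded01 _ _ (fun s => x 1%N s - x 0%N s)) => s s01.
  by apply: cvgB; [exact: (xc 1%N s s01)|exact: (xc 0%N s s01)].
have step k (s : R) : 0 <= s <= 1 ->
    `|x k.+1 s - x k s| <= c * 2^-1 ^+ k * expR (l * s).
  elim: k s => [|k IH] s s01.
    rewrite expr0 mulr1; apply: le_trans (xc01 s s01) _.
    rewrite ler_peMr // -expR0 ler_expR mulr_ge0 ?(ltW l0) //.
    by have [] := andP s01.
  have [s0 s1] := andP s01.
  have dsub (t : R) : 0 <= t <= s ->
      is_derive t 1 (fun r => x k.+2 r - x k.+1 r) ((x k.+1 t - x k t) *m C t).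
    move=> ts; have t01 : 0 <= t <= 1 by lra.
    have h1 := xd k.+1 t t01; have h2 := xd k t t01.
    by apply: is_derive_eq; rewrite mulmxBl.
  have := @mean_value_mx_le _ _ _ _ _ (fun t => c * 2^-1 ^+ k.+1 * expR (l * t))
    (fun t => c * 2^-1 ^+ k.+1 * (l * expR (l * t))) 0 s s0 dsub.
  rewrite !x0 subrr subr0 => h; apply: le_trans (h _ _) _.
  - move=> t ts.
    have he : is_derive t 1 (fun r : R => expR (l * r)) (l * expR (l * t)).
      exact: is_derive_scale_arg.
    by apply: is_derive_eq; rewrite /GRing.scale/=; ring.
  - move=> t ts; have t01 : 0 <= t <= 1 by lra.
    apply: le_trans (mx_norm_mul _ _) _.
    have h1 := IH t t01; have h2 := CL t t01.
    have h3 : `|x k.+1 t - x k t| * `|C t| <= c * 2^-1 ^+ k * expR (l * t) * L.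
      exact: ler_pM.
    have h4 : 0 <= c * 2^-1 ^+ k * expR (l * t).
      by rewrite !mulr_ge0 ?expR_ge0 // exprn_ge0.
    have h5 := ler_wpM2l (ler0n R N) h3.
    rewrite mulrA in h5; apply: le_trans h5 _.
    by rewrite exprS /l; nra.
  - by rewrite lerBlDr lerDl !mulr_ge0 ?expR_ge0 // exprn_ge0.
pose c' := c * expR l; have c'0 : 0 <= c' by rewrite mulr_ge0 ?expR_ge0.
have step' k (s : R) : 0 <= s <= 1 -> `|x k.+1 s - x k s| <= c' * 2^-1 ^+ k.
  move=> s01; apply: le_trans (step k s s01) _; rewrite /c' mulrAC.
  rewrite ler_wpM2r ?exprn_ge0 // ler_wpM2l // ler_expR ler_piMr ?(ltW l0) //.
  by have [] := andP s01.
(* The limit is taken entry by entry, at the clamped time, so that [y] is defined and continuous on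
   the whole line. *)
have /choice[y Hy] : forall s, exists y : 'rV[R]_N,
    forall k, `|y - x k (clamp01 s)| <= 2 * c' * 2^-1 ^+ k.
  move=> s; have s01 := clamp01_itv s.
  have /choice[l' Hl] : forall j : 'I_N, exists l : R,
      forall k, `|l - x k (clamp01 s) 0 j| <= 2 * c' * 2^-1 ^+ k.
    move=> j; apply: (@geometric_steps_cvg (fun k => x k (clamp01 s) 0 j)) => // k.
    have := step' k _ s01; apply: le_trans.
    by have := mx_norm_coord (x k.+1 (clamp01 s) - x k (clamp01 s)) 0 j; rewrite !mxE.
  exists (\row_j l' j) => k; apply: mx_norm_le => [|i j].
    by rewrite !mulr_ge0 // exprn_ge0.
  by rewrite !mxE ord1.
have tiny (K e' : R) : 0 <= K -> 0 < e' -> exists k, K * 2^-1 ^+ k < e'.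
  move=> K0 e'0.
  have /cvgrPdist_lt/(_ e' e'0)[k _ Hk] := @cvg_geometric R K 2^-1 ltac:(by rewrite ger0_norm // invf_lt1 // ltr1n).
  exists k; have /= := Hk k (leqnn k).
  by rewrite sub0r normrN ger0_norm // mulr_ge0 // exprn_ge0.
have yc : continuous y.
  move=> s; apply/cvgrPdist_lt => d d0.
  have [k Hk] := tiny (2 * c') (d / 3) ltac:(by rewrite mulr_ge0) ltac:(by rewrite divr_gt0).
  have /cvgrPdist_lt/(_ (d / 3) ltac:(by rewrite divr_gt0)) := comp_clamp _ (xc k) s.
  apply: filterS => t /= xst.
  have -> : y s - y t = (y s - x k (clamp01 s)) + (x k (clamp01 s) - x k (clamp01 t))
      - (y t - x k (clamp01 t)).
    by apply/matrixP => i j; rewrite !mxE; ring.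
  apply: le_lt_trans (ler_normB _ _) _.
  apply: le_lt_trans (lerD (ler_normD _ _) (lexx _)) _.
  have := Hy s k; have := Hy t k; lra.
have yc' : cont01 y by move=> s _; exact: yc.
(* [y] is constant outside [0, 1] and may lack a two-sided derivative at the ends. [T y] has one,
   and equals [y] on [0, 1] because both are limits of the iterates. *)
have [z0 zc zd] := HT _ yc'; exists (T y) => // s s01.
suff -> : T y s = y s by exact: zd.
apply/eqP; rewrite -subr_eq0 -normr_le0; apply/ler_addgt0Pr => d d0; rewrite add0r.
have [k Hk] := tiny (N%:R * (2 * c') * L + 2 * c') d
  ltac:(by rewrite addr_ge0 ?mulr_ge0) d0.
have [s0 s1] := andP s01.
have h1 : `|(T y s - x k.+1 s) - (T y 0 - x k.+1 0)| <=
    N%:R * (2 * c' * 2^-1 ^+ k) * L * (s - 0).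
  apply: (@mean_value_mx _ _ _ (fun t => T y t - x k.+1 t)
    (fun t => (y t - x k t) *m C t)) => // t ts.
    have t01 : 0 <= t <= 1 by lra.
    have h1 := zd t t01; have h2 := xd k t t01.
    by apply: is_derive_eq; rewrite mulmxBl.
  have t01 : 0 <= t <= 1 by lra.
  apply: le_trans (mx_norm_mul _ _) _.
  rewrite -mulrA -[leRHS]mulrA ler_wpM2l //; apply: ler_pM => //.
    by have := Hy t k; rewrite clamp01_id.
  exact: CL.
rewrite z0 x0 subrr !subr0 in h1.
have h2 := Hy s k.+1; rewrite clamp01_id // exprS in h2.
have -> : T y s - y s = (T y s - x k.+1 s) - (y s - x k.+1 s).
  by apply/matrixP => i j; rewrite !mxE; ring.
apply: le_trans (ler_normB _ _) _.
have h3 : N%:R * (2 * c' * 2^-1 ^+ k) * L * s <= N%:R * (2 * c' * 2^-1 ^+ k) * L.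
  by rewrite ler_piMr // !mulr_ge0 // exprn_ge0.
have h4 : 0 <= c' * 2^-1 ^+ k by rewrite mulr_ge0 // exprn_ge0.
apply: le_trans (lerD h1 h2) _.
lra.
Qed.

End LinearODE.

(** * Matrix equations: fundamental matrices, uniqueness, continuous dependence on parameters *)

Section LinearODEDependence.
Variable R : realType.

(** With the coefficient on the right, the rows of the unknown matrix solve separate equations. *)
Lemma linear_ode_exists_mx N (C : R -> 'M[R]_N) :
  continuous C -> exists2 X : R -> 'M[R]_N, X 0 = 1%:M &
  forall s : R, 0 <= s <= 1 -> is_derive s 1 X (X s *m C s).
Proof.
move=> Cc.
have /choice[x Hx] : forall i : 'I_N, exists x : R -> 'rV[R]_N, x 0 = row i 1%:M /\
    forall s : R, 0 <= s <= 1 -> is_derive s 1 x (x s *m C s).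
  by move=> i; have [x] := linear_ode_exists (row i 1%:M) Cc; exists x.
exists (fun s => \matrix_(i, j) x i s 0 j).
  by apply/matrixP => i j; rewrite !mxE (Hx i).1 !mxE.
move=> s s01; apply/is_derive_mxP => i j.
rewrite (_ : (fun _ => _) = fun t => x i t 0 j); last first.
  by apply/funext => t; rewrite mxE.
have /is_derive_mxP/(_ 0 j) := (Hx i).2 s s01.
rewrite !mxE; congr (is_derive _ _ _ _).
by apply: eq_bigr => k _; rewrite mxE.
Qed.

(** Gronwall's inequality with [e = 0]. Coefficients stand on both sides because the matrix of
    generators along a flow line is multiplied by a Jacobian on the left and by structure
    coefficients on the right; other uses take one or both to be 0. *)
Lemma linear_ode_unique0 m n (P : R -> 'M[R]_m) (C : R -> 'M[R]_n)
    (X : R -> 'M[R]_(m, n)) :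
  (forall s : R, 0 <= s <= 1 -> {for s, continuous P}) ->
  (forall s : R, 0 <= s <= 1 -> {for s, continuous C}) ->
  (forall s : R, 0 <= s <= 1 -> is_derive s 1 X (P s *m X s + X s *m C s)) ->
  X 0 = 0 -> forall s, 0 <= s <= 1 -> X s = 0.
Proof.
move=> Pc Cc Xd X0 s s01.
have [LP LP0 HP] := bounded01 Pc; have [LC LC0 HC] := bounded01 Cc.
have [|K K0 HK] := @gronwall R m n (m%:R * LP + n%:R * LC).
  by rewrite addr_ge0 // mulr_ge0.
apply/eqP; rewrite -normr_le0 -[leRHS](mulr0 K).
apply: (HK _ _ 0 _ _ Xd) => //; first by rewrite X0 normr0.
move=> t t01; rewrite addr0 mulrDl; apply: le_trans (ler_normD _ _) _.
apply: lerD; apply: le_trans (mx_norm_mul _ _) _.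
  by rewrite ler_wpM2r // ler_wpM2l // HP.
by rewrite -!mulrA ler_wpM2l // mulrC ler_wpM2r // HC.
Qed.

(** Transposition turns the left coefficient into a right one. Invertibility comes from the adjoint
    equation K' = - K P: the product K J has derivative 0 and so remains the identity. *)
Lemma fundamental_matrix N (P : R -> 'M[R]_N) :
  (forall s : R, 0 <= s <= 1 -> {for s, continuous P}) ->
  exists J : R -> 'M[R]_N, [/\ J 0 = 1%:M, J 1 \in unitmx &
    forall s : R, 0 <= s <= 1 -> is_derive s 1 J (P s *m J s)].
Proof.
move=> Pc.
have Pcc : continuous (fun s => P (clamp01 s)).
  move=> s; apply: (continuous_comp (@continuous_clamp01 R s)).
  exact/Pc/clamp01_itv.
have [X X0 Xd] := linear_ode_exists_mx (fun s => continuous_trmx (Pcc s)).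
have [K K0 Kd] := linear_ode_exists_mx (fun s => continuousN (Pcc s)).
have Jd (s : R) : 0 <= s <= 1 ->
    is_derive s 1 (fun t => (X t)^T) (P s *m (X s)^T).
  by move=> s01; have := is_derive_trmx (Xd s s01); rewrite trmx_mul trmxK clamp01_id.
exists (fun s => (X s)^T); split=> //; first by rewrite X0 trmx1.
suff : K 1 *m (X 1)^T = 1%:M by move=> /mulmx1_unit[].
apply/eqP; rewrite -subr_eq0; apply/eqP.
have s01 : 0 <= (1 : R) <= 1.
  by rewrite ler01 lexx.
apply: (@linear_ode_unique0 N N (fun=> 0) (fun=> 0)
  (fun s => K s *m (X s)^T - 1%:M)) => //.
- by move=> s _; exact: cst_continuous.
- by move=> s _; exact: cst_continuous.
- move=> s hs; have h := is_derive_mulmx (Kd s hs) (Jd s hs).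
  apply: is_derive_eq; rewrite subr0 mul0mx mulmx0 addr0 clamp01_id //.
  by rewrite mulmxN mulNmx mulmxA addNr.
- by rewrite K0 X0 trmx1 mulmx1 subrr.
Qed.

(** Compactness of [0, 1] yields one neighbourhood of [q0] that serves all times. The parameter
    space is left general: it is later a space of points as well as the line of increments [h]. *)
Lemma tube01 (V : topologicalType) (W : normedModType R) (f : R -> V -> W)
    (q0 : V) :
  (forall s : R, 0 <= s <= 1 -> {for (s, q0), continuous (fun z => f z.1 z.2)}) ->
  forall e : R, 0 < e ->
  \forall q \near q0, forall s : R, 0 <= s <= 1 -> `|f s q0 - f s q| < e.
Proof.
move=> fc e e0.
have /compact_near_coveringP := @segment_compact R 0 1.
move=> /(_ V (nbhs q0) (fun q s => `|f s q0 - f s q| < e)) cov.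
suff : \forall q \near q0, `[0, 1]%classic `<=` (fun s => `|f s q0 - f s q| < e).
  by apply: filterS => q h s s01; apply: h; rewrite /= in_itv.
apply: cov => s; rewrite /= in_itv/= => s01.
have e20 : 0 < e / 2 by rewrite divr_gt0.
have /cvgrPdist_lt/(_ _ e20)[[A B] [/= As Bq] AB] := fc s s01.
exists (A, B) => // -[t q] /= [At Bq'].
have h1 := AB (t, q) (conj At Bq').
have h2 := AB (t, q0) (conj At (nbhs_singleton Bq)).
rewrite /= in h1 h2.
have -> : f t q0 - f t q = (f s q0 - f t q) - (f s q0 - f t q0).
  by rewrite opprB [RHS]addrC subrKA.
by apply: le_lt_trans (ler_normB _ _) _; lra.
Qed.

Lemma joint_continuousl (V W : topologicalType) (f : R -> V -> W) (s : R) (q : V) :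
  {for (s, q), continuous (fun z => f z.1 z.2)} -> {for s, continuous (f^~ q)}.
Proof.
move=> fc; apply: (@continuous_comp _ _ _ (fun t => (t, q)) (fun z => f z.1 z.2)) => //.
move=> A [[B D] [/= Bs Dq] BD]; apply: filterS Bs => t Bt; apply: BD.
by split=> //=; exact: nbhs_singleton.
Qed.

(** The difference of the solutions at [q0] and [q] solves the equation of [q] with source
    [x t q0 *m (C t q0 - C t q)], which is uniformly small by [tube01]; Gronwall's inequality
    concludes. *)
Lemma linear_ode_cvg (V : topologicalType) N (C : R -> V -> 'M[R]_N)
    (x : R -> V -> 'rV[R]_N) (q0 : V) :
  (forall s : R, 0 <= s <= 1 -> {for (s, q0), continuous (fun z => C z.1 z.2)}) ->
  (\forall q \near q0, x 0 q = x 0 q0) ->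
  (\forall q \near q0, forall s : R, 0 <= s <= 1 ->
     is_derive s 1 (x^~ q) (x s q *m C s q)) ->
  forall e : R, 0 < e ->
  \forall q \near q0, forall s : R, 0 <= s <= 1 -> `|x s q0 - x s q| < e.
Proof.
move=> Cc x0 xd e e0.
have Cc0 (s : R) : 0 <= s <= 1 -> {for s, continuous (C^~ q0)}.
  by move=> /Cc; exact: joint_continuousl.
have [L L0 HL] := bounded01 Cc0.
have xd0 := nbhs_singleton xd.
have [K K0 HK] := bounded01 (fun s s01 => is_derive1_continuous (xd0 s s01)).
have [|G G0 HG] := @gronwall R 1 N (N%:R * (L + 1)).
  by rewrite mulr_ge0 // addr_ge0.
have GNK0 : 0 < G * (N%:R * K) + 1 by rewrite ltr_wpDl // !mulr_ge0 // ltW.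
(* At most 1, so that [L + 1] bounds the coefficients at nearby [q], and small enough for the
   Gronwall bound [G * (N%:R * K * d)] to fall below [e]. *)
pose d := Num.min 1 (e / (G * (N%:R * K) + 1)).
have d0 : 0 < d by rewrite lt_min ltr01 divr_gt0.
have d1 : d <= 1 by rewrite ge_min lexx.
have de : G * (N%:R * K * d) < e.
  have h : d * (G * (N%:R * K) + 1) <= e.
    by rewrite -ler_pdivlMr // ge_min lexx orbT.
  lra.
have Cd := tube01 Cc d0.
near=> q.
have Cq : forall s : R, 0 <= s <= 1 -> `|C s q0 - C s q| < d by near: q.
have xq : forall s : R, 0 <= s <= 1 -> is_derive s 1 (x^~ q) (x s q *m C s q).
  by near: q.
have x0q : x 0 q = x 0 q0 by near: q.
move=> s s01; apply: le_lt_trans de.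
have NKd0 : 0 <= N%:R * K * d by rewrite !mulr_ge0 // ltW.
apply: (HG (fun t => x t q0 - x t q)
  (fun t => (x t q0 - x t q) *m C t q + x t q0 *m (C t q0 - C t q))) => //.
- by rewrite x0q subrr normr0.
- move=> t t01; have h1 := xd0 t t01; have h2 := xq t t01.
  by apply: is_derive_eq; rewrite mulmxBl mulmxBr [RHS]addrC subrKA.
- move=> t t01; apply: le_trans (ler_normD _ _) _; apply: lerD.
    apply: le_trans (mx_norm_mul _ _) _.
    rewrite -!mulrA ler_wpM2l // mulrC ler_wpM2r //.
    have -> : C t q = C t q0 - (C t q0 - C t q) by rewrite opprB addrC subrK.
    apply: le_trans (ler_normB _ _) _; apply: lerD; first exact: HL.
    by apply: le_trans d1; apply/ltW/Cq.
  apply: le_trans (mx_norm_mul _ _) _; apply: ler_pM => //.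
  - by rewrite ler_wpM2l // HK.
  - exact/ltW/Cq.
Unshelve. all: by end_near. Qed.

End LinearODEDependence.

(** * Families of functions of class C^k *)

Section Families.
Variable R : realType.

Lemma is_derive_line (V W : normedModType R) (f : V -> W) x v (t : R) df :
  is_derive (x + t *: v) v f df ->
  is_derive t 1 (fun r : R => f (x + r *: v)) df.
Proof.
have E : (fun h : R => h^-1 *: (((fun r : R => f (x + r *: v)) \o shift t) (h *: 1)
      - f (x + t *: v))) =
    (fun h => h^-1 *: ((f \o shift (x + t *: v)) (h *: v) - f (x + t *: v))).
  apply/funext => h /=; congr (_ *: (f _ - _)).
  by rewrite scalerDl [h *: 1]mulr1 addrCA.
by case=> fd fE; split; rewrite /derivable /derive /= E.
Qed.

(** The segment is parametrised by [0, 1], so [h] may have either sign or vanish. *)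
Lemma mvt_line (V : normedModType R) (f : V -> R) x v (h : R) :
  (forall c, 0 <= c <= 1 -> derivable f (x + (h * c) *: v) v) ->
  exists2 c, 0 <= c <= 1 & f (x + h *: v) - f x = h * 'D_v f (x + (h * c) *: v).
Proof.
move=> fd.
have gd (c : R) : 0 <= c <= 1 -> is_derive c 1 (fun r => f (x + (h * r) *: v))
    (h * 'D_v f (x + (h * c) *: v)).
  move=> c01.
  apply: (@is_derive_scale_arg R _ (fun r => f (x + r *: v)) h c).
  exact/is_derive_line/derivableP/fd.
have [c||c] := @MVT_segment _ (fun r => f (x + (h * r) *: v))
    (fun c => h * 'D_v f (x + (h * c) *: v)) 0 1 ler01.
- by rewrite in_itv/= => /andP[? ?]; apply: gd; rewrite !ltW.
- by apply: derivable_within_continuous => c; rewrite in_itv/= => /gd[].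
- move=> /[!in_itv]/= c01; rewrite subr0 !mulr1 mulr0 scale0r addr0 => E.
  by exists c.
Qed.

Variable V : normedModType R.

(* [f s] is of class C^k on [U], and the parameter [s] enters only through
   joint continuity of all derivatives. *)
Fixpoint Ck_family (k : nat) (U : set V) (f : R -> V -> R) : Prop :=
  (forall s x, U x -> {for (s, x), continuous (fun z => f z.1 z.2)}) /\
  if k is k'.+1 then
    (forall s x v, U x -> derivable (f s) x v) /\
    (forall v, Ck_family k' U (fun s => 'D_v (f s)))
  else True.

Lemma Ck_family_continuous k U f s x : Ck_family k U f -> U x ->
  {for (s, x), continuous (fun z => f z.1 z.2)}.
Proof. by case: k => [|k] [fc _]; exact: fc. Qed.

Lemma Ck_family_pred k U f : Ck_family k.+1 U f -> Ck_family k U f.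
Proof.
elim: k f => [|k IH] f [fc [fd fD]]; first by split.
by split=> //; split=> // v; exact/IH/fD.
Qed.

Variable U : set V.
Hypothesis Uo : open U.

(** As [U] is open, functions equal on [U] are equal near each of its points and share their
    derivatives there; values off [U] stay arbitrary. *)
Lemma Ck_family_eq k f g : (forall s x, U x -> f s x = g s x) ->
  Ck_family k U f -> Ck_family k U g.
Proof.
have near_eq f' g' s x : (forall s x, U x -> f' s x = g' s x) -> U x ->
    \forall y \near x, f' s y = g' s y :> R.
  by move=> fg Ux; apply: filterS (open_nbhs_nbhs (conj Uo Ux)) => y; exact: fg.
have cont f' g' s x : (forall s x, U x -> f' s x = g' s x) -> U x ->
    {for (s, x), continuous (fun z : R * V => f' z.1 z.2 : R)} ->
    {for (s, x), continuous (fun z : R * V => g' z.1 z.2 : R)}.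
  move=> fg Ux fc; rewrite /prop_for /continuous_at /= -fg //.
  apply: cvg_trans fc; apply: near_eq_cvg.
  exists (setT, U); first by split=> //=; [exact: filterT|exact: open_nbhs_nbhs].
  by move=> [t y] [_ /= Uy]; rewrite fg.
elim: k f g => [|k IH] f g fg [fc fd].
  split=> // s x Ux; apply: (cont f) => //; exact: fc.
split; first by move=> s x Ux; apply: (cont f) => //; exact: fc.
split=> [s x v Ux|v].
  apply: near_eq_derivable (fd.1 s x v Ux); exact: near_eq.
apply: IH (fd.2 v) => s x Ux; apply: near_eq_derive; exact: near_eq.
Qed.

Lemma Ck_family_time k (c : R -> R) : continuous c -> Ck_family k U (fun s _ => c s).
Proof.
have cont (c' : R -> R) (s : R) (x : V) : continuous c' ->
    {for (s, x), continuous (fun z : R * V => c' z.1)}.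
  move=> cc A cA; exists (c' @^-1` A, setT); last by move=> [t y] [].
  by split=> /=; [exact: cc|exact: filterT].
elim: k c => [|k IH] c cc; first by split=> // s x _; exact: cont.
split; first by move=> s x _; exact: cont.
split=> [s x v _|v]; first exact: derivable_cst.
apply: Ck_family_eq (IH (fun=> 0) (@cst_continuous _ _ 0)) => s x _.
by rewrite derive_cst.
Qed.

Lemma Ck_familyD k f g : Ck_family k U f -> Ck_family k U g ->
  Ck_family k U (fun s x => f s x + g s x).
Proof.
elim: k f g => [|k IH] f g [fc fd] [gc gd].
  by split=> // s x Ux; apply: cvgD; [exact: fc|exact: gc].
split; first by move=> s x Ux; apply: cvgD; [exact: fc|exact: gc].
split=> [s x v Ux|v]; first by apply: derivableD; [exact: fd.1|exact: gd.1].
apply: Ck_family_eq (IH _ _ (fd.2 v) (gd.2 v)) => s x Ux.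
by rewrite deriveD //; [exact: fd.1|exact: gd.1].
Qed.

Lemma Ck_familyM k f g : Ck_family k U f -> Ck_family k U g ->
  Ck_family k U (fun s x => f s x * g s x).
Proof.
elim: k f g => [|k IH] f g [fc fd] [gc gd].
  by split=> // s x Ux; apply: cvgM; [exact: fc|exact: gc].
split; first by move=> s x Ux; apply: cvgM; [exact: fc|exact: gc].
split=> [s x v Ux|v]; first by apply: derivableM; [exact: fd.1|exact: gd.1].
have fk := Ck_family_pred (conj fc fd : Ck_family k.+1 U f).
have gk := Ck_family_pred (conj gc gd : Ck_family k.+1 U g).
apply: Ck_family_eq (Ck_familyD (IH _ _ fk (gd.2 v)) (IH _ _ gk (fd.2 v))) => s x Ux.
by rewrite deriveM //; [exact: fd.1|exact: gd.1].
Qed.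

Lemma Ck_family_sum k (I : Type) (r : seq I) (P : pred I) (f : I -> R -> V -> R) :
  (forall i, P i -> Ck_family k U (f i)) ->
  Ck_family k U (fun s x => \sum_(i <- r | P i) f i s x).
Proof.
move=> fk; elim: r => [|i r IH].
  apply: Ck_family_eq (Ck_family_time k (@cst_continuous _ _ 0)) => s x _.
  by rewrite big_nil.
have [Pi|nPi] := boolP (P i).
  apply: Ck_family_eq (Ck_familyD (fk i Pi) IH) => s x _.
  by rewrite big_cons Pi.
by apply: Ck_family_eq IH => s x _; rewrite big_cons (negbTE nPi).
Qed.

(** By the mean value theorem the quotient is the derivative at a point of the segment, so joint
    continuity of the derivative passes to it. Filling in [h = 0] makes it an admissible coefficient
    of a linear equation with parameter [h]. *)
Lemma diff_quotient_continuous (f : R -> V -> R) v q s :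
  Ck_family 1 U f -> U q ->
  {for (s, 0), continuous (fun z : R * R =>
    if z.2 == 0 then 'D_v (f z.1) q
    else z.2^-1 * (f z.1 (q + z.2 *: v) - f z.1 q))}.
Proof.
move=> [_ [fd fD]] Uq; apply/cvgrPdist_lt => e e0 /=; rewrite eqxx.
have /cvgrPdist_lt/(_ e e0)[[A B] [/= As Bq] AB] :=
  (fD v).1 s q Uq.
have line_cont : {for 0, continuous (fun h : R => q + h *: v)}.
  by apply: cvgD; [exact: cvg_cst|apply: cvgZr_tmp; exact: cvg_id].
have [r /= r0 Hr] : \forall h \near (0 : R), (B `&` U) (q + h *: v).
  apply: (line_cont (B `&` U)); rewrite scale0r addr0.
  by apply: filterI => //; exact: open_nbhs_nbhs.
exists (A, ball 0 r); first by split=> //=; exact: nbhsx_ballx.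
move=> [t h] [/= At hr].
have inBU c : 0 <= c <= 1 -> (B `&` U) (q + (h * c) *: v).
  move=> /andP[c0 c1]; apply: Hr; move: hr.
  rewrite /ball /= !sub0r !normrN => hr; rewrite normrM (le_lt_trans _ hr) //.
  by rewrite ler_piMr // ger0_norm.
case: eqP => [h0|/eqP h0].
  by have := AB (t, q) (conj At (nbhs_singleton Bq)).
have [c c01|c c01 ->] := @mvt_line V (f t) q v h.
  by apply: fd; have [] := inBU c c01.
rewrite mulKf //.
by have [Bc _] := inBU c c01; have := AB (t, _) (conj At Bc).
Qed.

End Families.

(** * Differentiability from continuous partial derivatives *)

Section SmoothOn.
Variable R : realType.

Lemma partials_differentiable p q (f : 'M[R]_(p, q) -> R) x :
  (forall i j, \forall y \near x, derivable f y (delta_mx i j)) ->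
  (forall i j, {for x, continuous ('D_(delta_mx i j) f)}) ->
  differentiable f x.
Proof.
move=> fd fc.
pose D i j := 'D_(delta_mx i j) f x.
pose df (h : 'M[R]_(p, q)) := \sum_(ij : 'I_p * 'I_q) h ij.1 ij.2 * D ij.1 ij.2.
have df_lin : linear df.
  move=> c h k; rewrite /df scaler_sumr -big_split; apply: eq_bigr => ij _ /=.
  by rewrite !mxE mulrDl -mulrA.
pose dfL := GRing.isLinear.Build _ _ _ _ df df_lin.
pose dfl : {linear 'M[R]_(p, q) -> R} := HB.pack df dfL.
have dfc : continuous dfl.
  move=> h; apply: (@continuous_sum R 'M[R]_(p, q)) => ij.
  apply: (@continuousM R 'M[R]_(p, q)); last exact: cst_continuous.
  exact: (@coord_continuous _ _ _ ij.1 ij.2 h).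
(* The increment [h] is built up one entry at a time along a list of indices; each new entry is
   handled by the mean value theorem on a coordinate line. *)
pose part (h : 'M[R]_(p, q)) r := \sum_(ij <- r) h ij.1 ij.2 *: delta_mx ij.1 ij.2.
have norm_delta i j : `|delta_mx i j : 'M[R]_(p, q)| <= 1.
  by apply: mx_norm_le => // a b; rewrite mxE; case: (_ && _); rewrite ?normr1 ?normr0.
have norm_part h r : `|part h r| <= (size r)%:R * `|h|.
  elim: r => [|ij r IH]; first by rewrite /part big_nil normr0 mul0r.
  rewrite /part big_cons; apply: le_trans (ler_normD _ _) _.
  rewrite -natr1 mulrDl mul1r [leRHS]addrC lerD // normrZ -[leRHS]mulr1 ler_pM //.
  exact: mx_norm_coord.
have small (e : R) r : 0 < e -> \forall h \near (0 : 'M[R]_(p, q)),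
    `|f (x + part h r) - f x - \sum_(ij <- r) h ij.1 ij.2 * D ij.1 ij.2|
      <= (size r)%:R * e * `|h|.
  move=> e0.
  have : \forall y \near x, forall ij : 'I_p * 'I_q,
      derivable f y (delta_mx ij.1 ij.2) /\
      `|D ij.1 ij.2 - 'D_(delta_mx ij.1 ij.2) f y| < e.
    apply: (@filter_forall _ _ _ (nbhs x)) => -[i j].
    near=> y; split; near: y; first exact: fd.
    by have /cvgrPdist_lt := fc i j; apply.
  move=> /nbhs_ballP[d /= d0 Hd].
  have sd0 : 0 < d / (size r).+1%:R by rewrite divr_gt0.
  have : \forall h \near (0 : 'M[R]_(p, q)), `|h| < d / (size r).+1%:R.
    by apply/nbhs_normP; exists (d / (size r).+1%:R) => // h; rewrite /= sub0r normrN.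
  apply: filterS => h; rewrite ltr_pdivlMr // mulrC => hd.
  elim: r hd {sd0} => [|[i j] r IH] hd.
    by rewrite /part !big_nil addr0 subrr subr0 normr0 !mul0r.
  have hd' : (size r).+1%:R * `|h| < d.
    by apply: le_lt_trans hd; rewrite ler_wpM2r // ler_nat /=.
  have {IH} := IH hd'.
  set F := part h r; set S := \sum_(ij <- r) _ => IH.
  have -> : part h ((i, j) :: r) = F + h i j *: delta_mx i j.
    by rewrite /part big_cons addrC.
  rewrite big_cons /= -/S.
  (* Each entry added costs at most the norm of [h], so the new segment stays within [(size r).+1]
     times that norm of [x]. *)
  have inb c : 0 <= c <= 1 -> ball x d (x + F + (h i j * c) *: delta_mx i j).
    move=> /andP[c0 c1]; rewrite -ball_normE /= -addrA opprD addNKr normrN.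
    apply: le_lt_trans hd'; apply: le_trans (ler_normD _ _) _.
    rewrite -natr1 mulrDl mul1r lerD //; first exact: norm_part.
    rewrite normrZ normrM -[leRHS]mulr1 -[leRHS]mulr1.
    rewrite !ler_pM ?mulr_ge0 //; first exact: mx_norm_coord.
    by rewrite ger0_norm.
  have [c c01|c c01 E] := @mvt_line R _ f (x + F) (delta_mx i j) (h i j).
    by have [] := Hd _ (inb c c01) (i, j).
  have [_ /= De] := Hd _ (inb c c01) (i, j).
  set D' := 'D_(_) f _ in De E.
  rewrite [x + (_ + _)]addrA.
  have -> : f (x + F + h i j *: delta_mx i j) - f x - (h i j * D i j + S) =
      (f (x + F) - f x - S) - h i j * (D i j - D').
    by rewrite -[X in X - f x](subrK (f (x + F))) E; ring.
  apply: le_trans (ler_normB _ _) _.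
  rewrite -natr1 !mulrDl mul1r lerD // normrM mulrC ler_pM //; first exact: ltW.
  exact: mx_norm_coord.
have all_part h : part h (index_enum _) = h.
  by rewrite /part [RHS]matrix_sum_delta pair_big.
have Dexp : f \o shift x = cst (f x) + dfl +o_ 0 id.
  apply/eqaddoP => e e0.
  have e'0 : 0 < e / (size (index_enum ('I_p * 'I_q)%type)).+1%:R by rewrite divr_gt0.
  have := small _ (index_enum _) e'0; apply: filterS => h.
  rewrite all_part => hs; rewrite !fctE /= opprD addrA [h + x]addrC.
  apply: le_trans hs _; rewrite ler_wpM2r // mulrCA ler_piMr ?ltW //.
  by rewrite ltr_pdivrMr // mul1r ltr_nat.
apply/diff_locallyP; have dE := diff_unique dfc Dexp.
split; last by rewrite dE.
by move=> h; have := dfc h; rewrite /continuous_at -dE.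
Unshelve. all: by end_near. Qed.

End SmoothOn.

(** * Passage between smooth functions and families of class C^k *)

Section SmoothFamilies.
Variable R : realType.

Lemma smooth_on_differentiable (V W : normedModType R) (D : set V) (f : V -> W) x :
  smooth_on D f -> D x -> differentiable f x.
Proof. by move=> /(_ 1%N)[fd _]; exact: fd. Qed.

Lemma smooth_on_derive (V W : normedModType R) (D : set V) (f : V -> W) v :
  smooth_on D f -> smooth_on D ('D_v f).
Proof. by move=> fs k; have [_] := fs k.+1; exact. Qed.

Lemma constant_family_continuous (V : normedModType R) (f : V -> R) (s : R) x :
  {for x, continuous f} -> {for (s, x), continuous (fun z : R * V => f z.2)}.
Proof.
move=> fc A /fc fA; exists (setT, f @^-1` A); last by move=> [t y] [].
by split=> //=; exact: filterT.
Qed.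

(** Used to read off the value at time 1 of a matrix solution as a function of the parameter
    alone. *)
Lemma Ck_family_freeze (V : normedModType R) k (U : set V) (f : R -> V -> R) s0 :
  Ck_family k U f -> Ck_family k U (fun _ => f s0).
Proof.
have cont (f' : R -> V -> R) x (s : R) : {for (s0, x), continuous (fun z => f' z.1 z.2)} ->
    {for (s, x), continuous (fun z : R * V => f' s0 z.2)}.
  move=> fc; apply: (@constant_family_continuous _ (f' s0)) => A fA.
  have [[B1 B2] [/= B10 B2x] B12] := fc A fA.
  apply: filterS B2x => y B2y; apply: (B12 (s0, y)); split=> //=.
  exact: (nbhs_singleton B10).
elim: k f => [|k IH] f [fc fd].
  by split=> // s x Ux; apply: cont; exact: fc.
split; first by move=> s x Ux; apply: cont; exact: fc.
split=> [s x v Ux|v]; first exact: (fd.1 s0 x v Ux).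
exact: IH (fd.2 v).
Qed.

Lemma Ck_family_coord k M (U : set 'rV[R]_M) i : open U ->
  Ck_family k U (fun _ p => p 0 i).
Proof.
move=> Uo.
have cont (s : R) (x : 'rV[R]_M) : {for (s, x), continuous (fun z : R * 'rV[R]_M => z.2 0 i)}.
  by apply: (@constant_family_continuous 'rV[R]_M (fun p => p 0 i)); exact: coord_continuous.
have D (x v : 'rV[R]_M) : is_derive x v (fun p => p 0 i) (v 0 i).
  by have /is_derive_mxP := is_derive_id x v; apply.
case: k => [|k]; first by split=> // s x _; exact: cont.
split; first by move=> s x _; exact: cont.
split=> [s x v _|v]; first by case: (D x v).
apply: Ck_family_eq (Ck_family_time Uo k (@cst_continuous R R (v 0 i))) => // s x _.
by have [_ ->] := D x v.
Qed.

Lemma Ck_family_mulmx (V : normedModType R) k (U : set V) m n q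
    (A : R -> V -> 'M[R]_(m, n)) (B : R -> V -> 'M[R]_(n, q)) :
  open U -> (forall i j, Ck_family k U (fun s p => A s p i j)) ->
  (forall i j, Ck_family k U (fun s p => B s p i j)) ->
  forall i j, Ck_family k U (fun s p => (A s p *m B s p) i j).
Proof.
move=> Uo Ak Bk i j.
have fam l : Ck_family k U (fun s p => A s p i l * B s p l j).
  exact: (Ck_familyM Uo (Ak i l) (Bk l j)).
apply: Ck_family_eq (Ck_family_sum Uo (index_enum _) (fun l _ => fam l)) => // s p _.
by rewrite mxE.
Qed.

Lemma Ck_on_sub (V W : normedModType R) k (D D' : set V) (f : V -> W) :
  D' `<=` D -> Ck_on k D f -> Ck_on k D' f.
Proof.
move=> D'D; elim: k f => [|k IH] f /=; first by move=> fc x /D'D; exact: fc.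
by move=> [fd fD]; split=> [x /D'D|v]; [exact: fd|exact: IH].
Qed.

Lemma is_derive_coord_diff (V : normedModType R) m n
    (f : V -> 'M[R]_(m, n)) x v i j :
  differentiable f x -> is_derive x v (fun y => f y i j) ('D_v f x i j).
Proof.
by move=> fd; have /derivableP/is_derive_mxP := @diff_derivable _ _ _ _ _ v fd; apply.
Qed.

Lemma smooth_on_Ck_family (V : normedModType R) m n (D : set V)
    (f : V -> 'M[R]_(m, n)) k i j :
  open D -> smooth_on D f -> Ck_family k D (fun _ x => f x i j).
Proof.
move=> Do; elim: k f => [|k IH] f fs.
  split=> // s x Dx; apply: (@constant_family_continuous V (fun x => f x i j)).
  have /differentiable_continuous := smooth_on_differentiable fs Dx.
  by move=> /continuous_mxP; apply.
have fd x v : D x -> is_derive x v (fun y => f y i j) ('D_v f x i j).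
  by move=> Dx; apply/is_derive_coord_diff/(smooth_on_differentiable fs Dx).
split.
  move=> s x Dx; apply: (@constant_family_continuous V (fun x => f x i j)).
  have /differentiable_continuous := smooth_on_differentiable fs Dx.
  by move=> /continuous_mxP; apply.
split=> [s x v Dx|v]; first by case: (fd x v Dx).
apply: Ck_family_eq (IH _ (smooth_on_derive v fs)) => // s x Dx.
by have [_ ->] := fd x v Dx.
Qed.

(** Families carry directional derivatives, whereas [Ck_on] asks for differentiability;
    [partials_differentiable] supplies it at every order. *)
Lemma Ck_family_smooth_on p q (D : set 'M[R]_(p, q)) (f : 'M[R]_(p, q) -> R) :
  open D -> (forall k, Ck_family k D (fun _ => f)) -> smooth_on D f.
Proof.
move=> Do fk k; elim: k f fk => [|k IH] f fk.
  move=> x Dx A fA.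
  have := (fk 0%N).1 0 x Dx A fA => -[[B1 B2] [/= B10 B2x] B12].
  apply: filterS B2x => y B2y; apply: (B12 (0, y)); split=> //=.
  exact: (nbhs_singleton B10).
split=> [x Dx|v]; last by apply: IH => k'; exact: (fk k'.+1).2.2.
apply: partials_differentiable => i j.
  apply: filterS (open_nbhs_nbhs (conj Do Dx)) => y Dy.
  exact: ((fk 1%N).2.1 0 y (delta_mx i j) Dy).

move=> A fA.
have := ((fk 1%N).2.2 (delta_mx i j)).1 0 x Dx A fA => -[[B1 B2] [/= B10 B2x] B12].
apply: filterS B2x => y B2y; apply: (B12 (0, y)); split=> //=.
exact: (nbhs_singleton B10).
Qed.

Lemma coord_differentiable (V : normedModType R) m n (f : V -> 'M[R]_(m, n)) x :
  (forall i j, differentiable (fun y => f y i j) x) -> differentiable f x.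
Proof.
move=> fd.
have -> : f = \sum_(i < m) \sum_(j < n) (fun y => f y i j *: delta_mx i j).
  apply/funext => y; rewrite [LHS]matrix_sum_delta fct_sumE.
  by apply: eq_bigr => i _; rewrite fct_sumE.
apply: differentiable_sum => i; apply: differentiable_sum => j.
exact: differentiableZl.
Qed.

Lemma Ck_family_smooth_on_mx p q m n (D : set 'M[R]_(p, q))
    (f : 'M[R]_(p, q) -> 'M[R]_(m, n)) :
  open D -> (forall k i j, Ck_family k D (fun _ x => f x i j)) -> smooth_on D f.
Proof.
move=> Do fk k; elim: k f fk => [|k IH] f fk.
  move=> x Dx; apply/continuous_mxP => i j.
  have fs : smooth_on D (fun x => f x i j).
    by apply: Ck_family_smooth_on => // k; exact: fk.
  exact: differentiable_continuous (smooth_on_differentiable fs Dx).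
have fd x : D x -> differentiable f x.
  move=> Dx; apply: coord_differentiable => i j.
  apply: (@smooth_on_differentiable _ _ D (fun x => f x i j)) => //.
  by apply: Ck_family_smooth_on => // k'; exact: fk.
split=> // v; apply: IH => k' i j.
apply: Ck_family_eq ((fk k'.+1 i j).2.2 v) => // s x Dx.
by have [_ ->] := is_derive_coord_diff v i j (fd x Dx).
Qed.

(** By the chain rule a derivative in [q] is a sum of terms [w j s * v 0 j] times a partial
    derivative of [f] at the same scaled point. The form is preserved by differentiation, and of [w]
    only continuity is used. *)
Lemma Ck_family_scale M (B U : set 'rV[R]_M) (f : 'rV[R]_M -> R)
    (w : 'I_M -> R -> R) k :
  open U -> (forall j, continuous (w j)) ->
  (forall s q, U q -> B (\row_j (w j s * q 0 j))) ->
  smooth_on B f -> Ck_family k U (fun s q => f (\row_j (w j s * q 0 j))).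
Proof.
move=> Uo wc UB.
pose sig (s : R) (q : 'rV[R]_M) : 'rV[R]_M := \row_j (w j s * q 0 j).
have sigc s q : {for (s, q), continuous (fun z => sig z.1 z.2)}.
  apply/continuous_mxP => i j.
  rewrite (_ : (fun _ => _) = (fun z : R * 'rV[R]_M => w j z.1 * z.2 0 j)); last first.
    by apply/funext => z; rewrite mxE.
  apply: (@continuousM R (R * 'rV[R]_M)%type (fun z => w j z.1) (fun z => z.2 0 j)).
    move=> A wA; exists (w j @^-1` A, setT); last by move=> [t y] [].
    by split=> /=; [exact: wc|exact: filterT].
  apply: (@constant_family_continuous 'rV[R]_M (fun q => q 0 j)).
  exact: coord_continuous.
elim: k f => [|k IH] f fs.
  split=> // s q Uq; apply: (continuous_comp (sigc s q)).
  exact: differentiable_continuous (smooth_on_differentiable fs (UB s q Uq)).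
have sigD s q v : U q ->
    is_derive q v (fun q => f (sig s q)) ('D_(sig s v) f (sig s q)).
  move=> Uq.
  have E : (fun h : R => h^-1 *: (((fun q => f (sig s q)) \o shift q) (h *: v)
        - f (sig s q))) =
      (fun h => h^-1 *: ((f \o shift (sig s q)) (h *: sig s v) - f (sig s q))).
    apply/funext => h /=; congr (_ *: (f _ - _)).
    by apply/matrixP => i j; rewrite !mxE; ring.
  have := @diff_derivable _ _ _ _ _ (sig s v) (smooth_on_differentiable fs (UB s q Uq)).
  by move=> fd; split; rewrite /derivable /derive /= E.
split.
  move=> s q Uq; apply: (continuous_comp (sigc s q)).
  exact: differentiable_continuous (smooth_on_differentiable fs (UB s q Uq)).
split=> [s q v Uq|v]; first by case: (sigD s q v Uq).
have fam j : Ck_family k U (fun s q => w j s * v 0 j * 'D_(delta_mx 0 j) f (sig s q)).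
  apply: Ck_familyM => //; last exact: (IH _ (smooth_on_derive (delta_mx 0 j) fs)).
  apply: Ck_family_time => // s.
  by apply: (@continuousM R R (w j)); [exact: wc|exact: cst_continuous].
apply: Ck_family_eq (Ck_family_sum Uo (index_enum _) (fun j _ => fam j)) => // s q Uq.
have [_ ->] := sigD s q v Uq.
have fd := smooth_on_differentiable fs (UB s q Uq).
rewrite deriveE // [sig s v]row_sum_delta raddf_sum; apply: eq_bigr => j _.
by rewrite [RHS]linearZ_LR mxE -deriveE.
Qed.

End SmoothFamilies.

(** * Smooth dependence of linear equations on parameters *)

Section FamilyODE.
Variables (R : realType) (V : normedModType R) (U : set V).
Hypothesis Uo : open U.

(** The initial row is common to all [q]; its derivative in [q] is 0, whence the initial value
    [row_mx e 0] of the block equation. *)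
Definition solves N (C : R -> V -> 'M[R]_N) (e : 'rV[R]_N)
    (x : R -> V -> 'rV[R]_N) :=
  forall q, U q -> x 0 q = e /\
    forall s : R, 0 <= s <= 1 -> is_derive s 1 (x^~ q) (x s q *m C s q).

(** Solutions at nearby parameters are close uniformly in time, and each one is continuous in time.
    The clamp gives a statement for every real [s], as families require. *)
Lemma solution_continuous N (C : R -> V -> 'M[R]_N) e x :
  (forall i j, Ck_family 0 U (fun s q => C s q i j)) -> solves C e x ->
  forall s q, U q ->
    {for (s, q), continuous (fun z : R * V => x (clamp01 z.1) z.2)}.
Proof.
move=> Cc sol s q Uq; apply/cvgrPdist_lt => d d0.
have d20 : 0 < d / 2 by rewrite divr_gt0.
have Uq' : \forall r \near q, U r by exact: open_nbhs_nbhs.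
have near_q : \forall r \near q, forall t : R, 0 <= t <= 1 ->
    `|x t q - x t r| < d / 2.
  apply: (@linear_ode_cvg R V N C) d20.
  - by move=> t _; apply/continuous_mxP => i j; exact: (Cc i j).1.
  - by apply: filterS Uq' => r Ur; rewrite (sol r Ur).1 (sol q Uq).1.
  - by apply: filterS Uq' => r Ur; exact: (sol r Ur).2.
have c01 := clamp01_itv s.
have xc : {for s, continuous (fun t => x (clamp01 t) q)}.
  exact: (continuous_comp (@continuous_clamp01 R s)
    (is_derive1_continuous ((sol q Uq).2 _ c01))).
have /cvgrPdist_lt/(_ _ d20) xcl := xc.
exists ([set t | `|x (clamp01 s) q - x (clamp01 t) q| < d / 2],
  [set r | forall t : R, 0 <= t <= 1 -> `|x t q - x t r| < d / 2]) => //.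
move=> [t r] [/= h1 h2]; have h3 := h2 _ (clamp01_itv t).
rewrite -(subrKA (x (clamp01 t) q)).
by apply: le_lt_trans (ler_normD _ _) _; lra.
Qed.

(** Applied to [row_mx x w], this is the variational equation: x' = x C and w' = x (D_v C) + w C. *)
Definition block_coef N (C : R -> V -> 'M[R]_N) (v : V) (s : R) (q : V) :
    'M[R]_(N + N) :=
  block_mx (C s q) (\matrix_(i, j) 'D_v (fun q => C s q i j) q) 0 (C s q).

Lemma block_coef_Ck k N (C : R -> V -> 'M[R]_N) v :
  (forall i j, Ck_family k.+1 U (fun s q => C s q i j)) ->
  forall i j, Ck_family k U (fun s q => block_coef C v s q i j).
Proof.
move=> Ck i j; rewrite /block_coef.
have C0 i' j' := Ck_family_pred (Ck i' j').
case: (split_ordP i) => i' ->; case: (split_ordP j) => j' ->.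
- by apply: Ck_family_eq (C0 i' j') => // s q _; rewrite block_mxEul.
- apply: Ck_family_eq ((Ck i' j').2.2 v) => // s q _.
  by rewrite block_mxEur mxE.
- apply: Ck_family_eq (Ck_family_time Uo k (@cst_continuous _ _ 0)) => // s q _.
  by rewrite block_mxEdl mxE.
- by apply: Ck_family_eq (C0 i' j') => // s q _; rewrite block_mxEdr.
Qed.

Lemma solves_exists N (C : R -> V -> 'M[R]_N) (e : 'rV[R]_N) :
  (forall i j, Ck_family 0 U (fun s q => C s q i j)) -> exists x, solves C e x.
Proof.
move=> Cc.
have /choice[x Hx] : forall q, exists x : R -> 'rV[R]_N, U q -> x 0 = e /\
    forall s : R, 0 <= s <= 1 -> is_derive s 1 x (x s *m C s q).
  move=> q; have [Uq|nUq] := pselect (U q); last by exists (fun=> 0).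
  have [|x x0 xd] := @linear_ode_exists R N (C^~ q) e; last by exists x.
  move=> s; apply/continuous_mxP => i j.
  apply: (@joint_continuousl R V R (fun s q => C s q i j)).
  exact: (Cc i j).1.
by exists (fun s q => x q s).
Qed.

(* For [h <> 0] the pair ([x s q], difference quotient of [x s] at [q]) solves a
   linear equation whose coefficient tends to [block_coef C v s q] as [h]
   tends to 0, so differentiability in [q] is continuous dependence on [h]. *)
Lemma solution_derive N (C : R -> V -> 'M[R]_N) e x v z :
  (forall i j, Ck_family 1 U (fun s q => C s q i j)) -> solves C e x ->
  solves (block_coef C v) (row_mx e 0) z ->
  forall q, U q -> forall s : R, 0 <= s <= 1 ->
    is_derive q v (x s) (rsubmx (z s q)).
Proof.
move=> C1 xsol zsol q Uq.
pose w s := rsubmx (z s q).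
have C0 i j := Ck_family_pred (C1 i j).
have Ccont q' (s : R) : U q' -> {for s, continuous (C^~ q')}.
  move=> Uq'; apply/continuous_mxP => i j.
  apply: (@joint_continuousl R V R (fun s q => C s q i j)).
  exact: (C0 i j).1.
have lsub_derive (s : R) (u : R -> 'rV[R]_(N + N)) du : is_derive s 1 u du ->
    is_derive s 1 (fun t => lsubmx (u t)) (lsubmx du).
  move=> /is_derive_mxP ud; apply/is_derive_mxP => i j.
  rewrite (_ : (fun _ => _) = (fun t => u t i (lshift N j))); last first.
    by apply/funext => t; rewrite mxE.
  by rewrite mxE.
have rsub_derive (s : R) (u : R -> 'rV[R]_(N + N)) du : is_derive s 1 u du ->
    is_derive s 1 (fun t => rsubmx (u t)) (rsubmx du).
  move=> /is_derive_mxP ud; apply/is_derive_mxP => i j.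
  rewrite (_ : (fun _ => _) = (fun t => u t i (rshift N j))); last first.
    by apply/funext => t; rewrite mxE.
  by rewrite mxE.
have row_derive (s : R) (u1 u2 : R -> 'rV[R]_N) d1 d2 :
    is_derive s 1 u1 d1 -> is_derive s 1 u2 d2 ->
    is_derive s 1 (fun t => row_mx (u1 t) (u2 t)) (row_mx d1 d2).
  move=> /is_derive_mxP h1 /is_derive_mxP h2; apply/is_derive_mxP => i j.
  case: (split_ordP j) => j' ->.
    rewrite row_mxEl (_ : (fun _ => _) = (fun t => u1 t i j')) //.
    by apply/funext => t; rewrite row_mxEl.
  rewrite row_mxEr (_ : (fun _ => _) = (fun t => u2 t i j')) //.
  by apply/funext => t; rewrite row_mxEr.
pose DC s := \matrix_(i, j) 'D_v (fun q => C s q i j) q.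
have zE (s : R) : z s q = row_mx (lsubmx (z s q)) (w s) by rewrite hsubmxK.
(* The lower left block is 0, so the left half of [z] solves the same equation as [x]. *)
have zl (s : R) : 0 <= s <= 1 -> lsubmx (z s q) = x s q.
  move=> s01; apply/eqP; rewrite -subr_eq0; apply/eqP; move: s s01.
  apply: (@linear_ode_unique0 R 1 N (fun=> 0) (C^~ q)
    (fun s => lsubmx (z s q) - x s q)).
  - by move=> s _; exact: cst_continuous.
  - by move=> s _; exact: Ccont.
  - move=> s s01; have h1 := lsub_derive _ _ _ ((zsol q Uq).2 s s01).
    have h2 := (xsol q Uq).2 s s01.
    apply: is_derive_eq; rewrite mul0mx add0r mulmxBl; congr (_ - _).
    by rewrite [z s q]zE mul_row_block row_mxKl mulmx0 addr0 row_mxKl.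
  - by rewrite (zsol q Uq).1 (xsol q Uq).1 row_mxKl subrr.
have wd (s : R) : 0 <= s <= 1 -> is_derive s 1 w (x s q *m DC s + w s *m C s q).
  move=> s01; have := rsub_derive _ _ _ ((zsol q Uq).2 s s01).
  rewrite {1}[z s q]zE mul_row_block row_mxKr.
  by rewrite zl.
pose quot h s := h^-1 *: (x s (q + h *: v) - x s q).
(* From x_h C_h - x C = (x_h - x) C_h + x (C_h - C): the lower right block is taken at the shifted
   point, the upper right one is a difference quotient. *)
pose Cq (s h : R) : 'M[R]_(N + N) := block_mx (C s q)
  (if h == 0 then DC s else h^-1 *: (C s (q + h *: v) - C s q))
  0 (C s (q + h *: v)).
pose X (s h : R) : 'rV[R]_(N + N) := row_mx (x s q) (if h == 0 then w s else quot h s).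
have line_cont : {for 0, continuous (fun h : R => q + h *: v)}.
  by apply: cvgD; [exact: cvg_cst|apply: cvgZr_tmp; exact: cvg_id].
have near_U : \forall h \near (0 : R), U (q + h *: v).
  by apply: (line_cont U); rewrite scale0r addr0; exact: open_nbhs_nbhs.
have Cqc (s : R) : 0 <= s <= 1 -> {for (s, 0), continuous (fun z => Cq z.1 z.2)}.
  move=> _; apply/continuous_mxP => i j; rewrite /Cq.
  have shifted i' j' : {for (s, 0), continuous (fun z : R * R => C z.1 (q + z.2 *: v) i' j')}.
    apply: (@continuous_comp _ _ _ (fun z : R * R => (z.1, q + z.2 *: v))
      (fun z => C z.1 z.2 i' j')); last first.
      by rewrite /= scale0r addr0; exact: (C0 i' j').1.
    move=> A [[A1 A2] [/= A1s A2q] A12].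
    exists (A1, (fun h => q + h *: v) @^-1` A2); last by move=> [t h] [? ?]; exact: A12.
    by split=> //=; apply: line_cont.
  case: (split_ordP i) => i' ->; case: (split_ordP j) => j' ->.
  - rewrite (_ : (fun _ => _) = (fun z : R * R => C z.1 q i' j')); last first.
      by apply/funext => t; rewrite block_mxEul.
    move=> A /(joint_continuousl ((C0 i' j').1 s q Uq)) /= As.
    exists ((fun t => C t q i' j') @^-1` A, setT); last by move=> [t h] [].
    by split=> //=; exact: filterT.
  - rewrite (_ : (fun _ => _) = (fun z : R * R =>
      if z.2 == 0 then 'D_v (fun q => C z.1 q i' j') q
      else z.2^-1 * (C z.1 (q + z.2 *: v) i' j' - C z.1 q i' j'))).
      exact: (@diff_quotient_continuous R V U Uo (fun s q => C s q i' j')).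
    by apply/funext => t; rewrite block_mxEur; case: ifP => _; rewrite !mxE.
  - rewrite (_ : (fun _ => _) = (fun=> 0)); first exact: cst_continuous.
    by apply/funext => t; rewrite block_mxEdl mxE.
  - rewrite (_ : (fun _ => _) = (fun z : R * R => C z.1 (q + z.2 *: v) i' j')) //.
    by apply/funext => t; rewrite block_mxEdr.
have Xd : \forall h \near (0 : R), forall s : R, 0 <= s <= 1 ->
    is_derive s 1 (X^~ h) (X s h *m Cq s h).
  apply: filterS near_U => h Uh s s01; rewrite /X /Cq mul_row_block mulmx0 addr0.
  have xd := (xsol q Uq).2 s s01.
  case: eqP => [->|/eqP h0].
    by rewrite scale0r addr0; apply: row_derive => //; exact: wd.
  apply: row_derive => //.
  have xhd := (xsol _ Uh).2 s s01.
  rewrite /quot.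
  apply: is_derive_eq; rewrite -scalemxAr -scalemxAl -scalerDr; congr (_ *: _).
  by rewrite mulmxBr mulmxBl [RHS]addrC subrKA.
have X0 : \forall h \near (0 : R), X 0 h = X 0 0.
  apply: filterS near_U => h Uh; rewrite /X eqxx; congr row_mx.
  rewrite /w (zsol q Uq).1 row_mxKr; case: eqP => // _.
  by rewrite /quot (xsol _ Uh).1 (xsol _ Uq).1 subrr scaler0.
move=> s s01.
have lim_quot : h^-1 *: ((x s \o shift q) (h *: v) - x s q) @[h --> 0^'] --> w s.
  apply/cvgrPdist_lt => d d0.
  have /nbhs_dnbhs := linear_ode_cvg Cqc X0 Xd d0.
  have /filterS2 := nbhs_dnbhs_neq (0 : R); apply => h h0 /(_ s s01).
  rewrite /X eqxx (negbTE h0) opp_row_mx add_row_mx subrr /quot /= [h *: v + q]addrC.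
  apply: le_lt_trans; apply: mx_norm_le => // i j.
  by rewrite -(row_mxEr (0 : 'rV_N)) mx_norm_coord.
by split; [apply/cvg_ex; exists (w s)|exact/cvg_lim].
Qed.

(** A derivative in [q] is the right half of a solution of the block equation, whose coefficient is
    of one class less. The size doubles, so the induction on [k] generalises over [N]. *)
Lemma solution_Ck k N (C : R -> V -> 'M[R]_N) e x :
  (forall i j, Ck_family k U (fun s q => C s q i j)) -> solves C e x ->
  forall i j, Ck_family k U (fun s q => x (clamp01 s) q i j).
Proof.
elim: k N C e x => [|k IH] N C e x Ck xsol i j.
  split=> // s q Uq.
  by have /continuous_mxP := solution_continuous Ck xsol (s := s) Uq; apply.
have C0 i' j' : Ck_family 0 U (fun s q => C s q i' j') by split=> //; exact: (Ck i' j').1.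
have C1 i' j' : Ck_family 1 U (fun s q => C s q i' j').
  have [cc [cd cD]] := Ck i' j'; split=> //; split=> // v; split=> //.
  by move=> s q; exact: Ck_family_continuous (cD v).
split.
  move=> s q Uq.
  by have /continuous_mxP := solution_continuous C0 xsol (s := s) Uq; apply.
have bc v := block_coef_Ck v Ck.
have bc0 v i' j' : Ck_family 0 U (fun s q => block_coef C v s q i' j').
  by split=> // s q; exact: Ck_family_continuous (bc v i' j').
have xd v z : solves (block_coef C v) (row_mx e 0) z -> forall s q, U q ->
    is_derive q v (fun q => x (clamp01 s) q i j) (rsubmx (z (clamp01 s) q) i j).
  move=> zsol s q Uq.
  have /is_derive_mxP := solution_derive C1 xsol zsol Uq (clamp01_itv s); exact.
split=> [s q v Uq|v].
  by have [z zsol] := solves_exists (row_mx e 0) (bc0 v); case: (xd v z zsol s q Uq).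
have [z zsol] := solves_exists (row_mx e 0) (bc0 v).
apply: Ck_family_eq (IH _ _ _ _ (bc v) zsol i (rshift N j)) => // s q Uq.
by have [_ ->] := xd v z zsol s q Uq; rewrite mxE.
Qed.

End FamilyODE.

(** * Smooth vector fields and their local flows *)

Section VectorFields.
Variables (R : realType) (n : nat).
Implicit Types X Y Z : 'cV[R]_n -> 'cV[R]_n.

Lemma derive_coord_sum (W : normedModType R) (F : 'cV[R]_n -> W) x v :
  differentiable F x ->
  'D_v F x = \sum_k v k 0 *: 'D_(delta_mx k 0) F x.
Proof.
move=> Fd; rewrite deriveE //.
have {1}-> : v = \sum_k v k 0 *: delta_mx k 0.
  by rewrite [LHS]matrix_sum_delta; apply: eq_bigr => k _; rewrite big_ord1.
rewrite raddf_sum; apply: eq_bigr => k _.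
by rewrite [LHS]linearZ deriveE.
Qed.

Lemma derive_jac m (F : 'cV[R]_n -> 'cV[R]_m) x v :
  differentiable F x -> 'D_v F x = jac F x *m v.
Proof.
move=> Fd; rewrite derive_coord_sum //; apply/matrixP => i j.
by rewrite summxE !mxE ord1; apply: eq_bigr => k _; rewrite !mxE mulrC.
Qed.

Lemma smooth_on_jac m (F : 'cV[R]_n -> 'cV[R]_m) :
  smooth_on setT F -> smooth_on setT (jac F).
Proof.
move=> Fs; apply: Ck_family_smooth_on_mx => [|k i j]; first exact: openT.
apply: Ck_family_eq (smooth_on_Ck_family k i 0 openT
  (smooth_on_derive (delta_mx j 0) Fs)) => [|s x _]; first exact: openT.
by rewrite mxE.
Qed.

(** [smallest] is an intersection, so the generated algebra consists of smooth fields as soon as the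
    smooth fields form one of the algebras intersected. *)
Lemma smooth_lie_algebra :
  lie_algebra (smooth_on setT : set ('cV[R]_n -> 'cV[R]_n)).
Proof.
have oT := @openT 'cV[R]_n.
split=> [//||X Y Xs Ys|c X Xs|X Y Xs Ys]; apply: Ck_family_smooth_on_mx => // k i j.
- apply: Ck_family_eq (Ck_family_time oT k (@cst_continuous _ _ 0)) => // s x _.
  by rewrite mxE.
- apply: Ck_family_eq (Ck_familyD oT (smooth_on_Ck_family k i j oT Xs)
    (smooth_on_Ck_family k i j oT Ys)) => // s x _.
  by rewrite mxE.
- apply: Ck_family_eq (Ck_familyM oT (Ck_family_time oT k (@cst_continuous _ _ c))
    (smooth_on_Ck_family k i j oT Xs)) => // s x _.
  by rewrite mxE.
- have half (F H : 'cV[R]_n -> 'cV[R]_n) : smooth_on setT F -> smooth_on setT H ->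
      Ck_family k setT (fun (_ : R) x => (jac F x *m H x) i j).
    move=> Fs Hs.
    have fam l : Ck_family k setT (fun (_ : R) x => jac F x i l * H x l j).
      exact: (Ck_familyM oT (smooth_on_Ck_family k i l oT (smooth_on_jac Fs))
        (smooth_on_Ck_family k l j oT Hs)).
    apply: Ck_family_eq (Ck_family_sum oT (index_enum _) (fun l _ => fam l)) => // s x _.
    by rewrite mxE.
  have minus := Ck_familyM oT (Ck_family_time oT k (@cst_continuous R R (-1)))
    (half X Y Xs Ys).
  apply: (Ck_family_eq oT _ (Ck_familyD oT (half Y X Ys Xs) minus)) => s x _.
  by rewrite !mxE mulN1r.
Qed.

Lemma gen_lie_smooth m (g : 'I_m -> 'cV[R]_n -> 'cV[R]_n) Z :
  (forall i, smooth_on setT (g i)) -> gen_lie g Z -> smooth_on setT Z.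
Proof.
move=> gs; apply; split; first exact: smooth_lie_algebra.
by move=> _ [i _ <-]; exact: gs.
Qed.

Lemma gen_lie_bracket m (g : 'I_m -> 'cV[R]_n -> 'cV[R]_n) X Y :
  gen_lie g X -> gen_lie g Y -> gen_lie g (lie_bracket X Y).
Proof.
move=> gX gY A CA; have [_ _ _ _ AB] := CA.1.
by apply: AB; [exact: gX|exact: gY].
Qed.

Lemma convex_lt (a b r t : R) : a < r -> b < r -> 0 <= t <= 1 ->
  (1 - t) * a + t * b < r.
Proof.
move=> ar br /andP[t0 t1].
have h1 : 0 <= (1 - t) * (r - a) by rewrite mulr_ge0 // subr_ge0 // ltW.
have [t00|t00] := leP t 0; first by have -> : t = 0; [lra|lra].
have h2 : 0 < t * (r - b) by rewrite mulr_gt0 // subr_gt0.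
lra.
Qed.

(** Near [x0] each partial derivative exceeds its value there by at most 1 in norm; balls are
    convex, so the mean value inequality applies on segments. *)
Lemma locally_lipschitz m p (F : 'cV[R]_n -> 'M[R]_(m, p)) x0 :
  smooth_on setT F -> exists r L : R, [/\ 0 < r, 0 <= L &
    forall x y, `|x - x0| < r -> `|y - x0| < r -> `|F x - F y| <= L * `|x - y|].
Proof.
move=> Fs.
have DFc k : {for x0, continuous ('D_(delta_mx k 0) F)}.
  exact: differentiable_continuous (smooth_on_differentiable (smooth_on_derive _ Fs) I).
have : \forall x \near x0, forall k : 'I_n,
    `|'D_(delta_mx k 0) F x0 - 'D_(delta_mx k 0) F x| < 1.
  apply: (@filter_forall _ _ _ (nbhs x0)) => k.
  by have /cvgrPdist_lt := DFc k; apply.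
move=> /nbhs_normP[r /= r0 Hr].
pose L := \sum_(k < n) (`|'D_(delta_mx k 0) F x0| + 1).
have L0 : 0 <= L by apply: sumr_ge0 => k _; rewrite addr_ge0.
exists r, L; split=> // x y xr yr.
have seg (t : R) : 0 <= t <= 1 -> `|x0 - (y + t *: (x - y))| < r.
  move=> t01.
  have -> : x0 - (y + t *: (x - y)) = - ((1 - t) *: (y - x0) + t *: (x - x0)).
    by apply/matrixP => i j; rewrite !mxE; ring.
  rewrite normrN; apply: le_lt_trans (ler_normD _ _) _; rewrite !normrZ.
  rewrite !ger0_norm; [|lra|lra].
  exact: convex_lt.
have Fd (t : R) : 0 <= t <= 1 -> is_derive t 1 (fun s => F (y + s *: (x - y)))
    ('D_(x - y) F (y + t *: (x - y))).
  move=> _; apply: is_derive_line; apply/derivableP/diff_derivable.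
  exact: smooth_on_differentiable Fs I.
have := @mean_value_mx _ _ _ _ _ 0 1 (L * `|x - y|) ler01 Fd.
rewrite scale1r scale0r addr0 subr0 mulr1 [y + (x - y)]addrC subrK; apply => t t01.
rewrite derive_coord_sum; last exact: smooth_on_differentiable Fs I.
apply: le_trans (ler_norm_sum _ _ _) _.
rewrite /L mulr_suml; apply: ler_sum => k _.
rewrite normrZ mulrC ler_pM //; last exact: mx_norm_coord.
have t01' : 0 <= t <= 1 by lra.
have := Hr _ (seg t t01') k => /ltW h.
set A := 'D_(_) F x0 in h *; set B := 'D_(_) F _ in h *.
have -> : B = A - (A - B) by rewrite opprB addrC subrK.
exact: le_trans (ler_normB _ _) (lerD (lexx _) h).
Qed.

(** The last estimate is the mean value inequality for [Y] minus its linear part: the derivative is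
    an increment of [jac Y], which is Lipschitz, and this gives the square of the distance. *)
Lemma field_estimates Y x0 : smooth_on setT Y ->
  exists r L : R, [/\ 0 < r, 0 <= L,
    forall x, `|x - x0| < r -> `|Y x| <= L /\ `|jac Y x| <= L,
    forall x y, `|x - x0| < r -> `|y - x0| < r -> `|Y x - Y y| <= L * `|x - y| &
    forall x y, `|x - x0| < r -> `|y - x0| < r ->
      `|Y y - Y x - jac Y x *m (y - x)| <= L * `|y - x| ^+ 2].
Proof.
move=> Ys; have Js := smooth_on_jac Ys.
have [r1 [L1 [r10 L10 H1]]] := locally_lipschitz x0 Ys.
have [r2 [L2 [r20 L20 H2]]] := locally_lipschitz x0 Js.
pose r := Num.min r1 r2.
have rr1 : r <= r1 by rewrite ge_min lexx.
have rr2 : r <= r2 by rewrite ge_min lexx orbT.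
have r0 : 0 < r by rewrite lt_min r10.
(* A sum of all the constants that occur, so that one [L] serves every bound. *)
pose L := `|Y x0| + L1 * r + (`|jac Y x0| + L2 * r) + L1 + n%:R * L2.
have L1r : 0 <= L1 * r by rewrite mulr_ge0 // ltW.
have L2r : 0 <= L2 * r by rewrite mulr_ge0 // ltW.
have nL2 : 0 <= n%:R * L2 by rewrite mulr_ge0.
have nY := normr_ge0 (Y x0); have nJ := normr_ge0 (jac Y x0).
have in1 x : `|x - x0| < r -> `|x - x0| < r1 by move=> h; exact: lt_le_trans rr1.
have in2 x : `|x - x0| < r -> `|x - x0| < r2 by move=> h; exact: lt_le_trans rr2.
have x00 s : 0 < s -> `|x0 - x0| < s by rewrite subrr normr0.
exists r, L; split=> //; first by rewrite /L; lra.
- move=> x xr; split.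
    have h := H1 x x0 (in1 x xr) (x00 _ r10).
    have h' : L1 * `|x - x0| <= L1 * r by rewrite ler_wpM2l // ltW.
    rewrite -[Y x](subrK (Y x0)); apply: le_trans (ler_normD _ _) _.
    by rewrite /L; lra.
  have h := H2 x x0 (in2 x xr) (x00 _ r20).
  have h' : L2 * `|x - x0| <= L2 * r by rewrite ler_wpM2l // ltW.
  rewrite -[jac Y x](subrK (jac Y x0)); apply: le_trans (ler_normD _ _) _.
  by rewrite /L; lra.
- move=> x y xr yr; apply: le_trans (H1 x y (in1 x xr) (in1 y yr)) _.
  by rewrite ler_wpM2r // /L; lra.
- move=> x y xr yr.
  pose u (t : R) := Y (x + t *: (y - x)) - t *: (jac Y x *m (y - x)).
  pose du (t : R) := (jac Y (x + t *: (y - x)) - jac Y x) *m (y - x).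
  have ud (t : R) : 0 <= t <= 1 -> is_derive t 1 u (du t).
    move=> _.
    have h1 : is_derive t 1 (fun s : R => Y (x + s *: (y - x)))
        (jac Y (x + t *: (y - x)) *m (y - x)).
      apply: is_derive_line; rewrite -derive_jac; last exact: smooth_on_differentiable Ys I.
      exact/derivableP/diff_derivable/(smooth_on_differentiable Ys I).
    have h2 : is_derive t 1 (fun s : R => s *: (jac Y x *m (y - x))) (jac Y x *m (y - x)).
      have h := @is_derive_line R 'cV[R]_n 'cV[R]_n id 0 (jac Y x *m (y - x)) t _
        (is_derive_id _ _).
      rewrite (_ : (fun _ => _) = (fun s : R => 0 + s *: (jac Y x *m (y - x)))) //.
      by apply/funext => s; rewrite add0r.
    by apply: is_derive_eq; rewrite /du mulmxBl.
  have : `|u 1 - u 0| <= n%:R * (L2 * `|y - x|) * `|y - x| * (1 - 0).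
    apply: mean_value_mx ud _ => // t t01; apply: le_trans (mx_norm_mul _ _) _.
    rewrite ler_wpM2r // ler_wpM2l //.
    have E : x + t *: (y - x) - x0 = (1 - t) *: (x - x0) + t *: (y - x0).
      by apply/matrixP => i j; rewrite !mxE; ring.
    have hr : `|x + t *: (y - x) - x0| < r.
      rewrite E; apply: le_lt_trans (ler_normD _ _) _; rewrite !normrZ.
      by rewrite !ger0_norm; [apply: convex_lt => //; lra|lra|lra].
    apply: le_trans (H2 _ _ (in2 _ hr) (in2 x xr)) _.
    rewrite ler_wpM2l // addrC addKr normrZ ger0_norm; last by lra.
    by rewrite ler_piMl //; lra.
  rewrite /u !scale1r scale0r subr0 addr0 scale0r subr0 mulr1 [x + (y - x)]addrC subrK.
  move=> h; rewrite addrAC. apply: le_trans h _.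
  have -> : n%:R * (L2 * `|y - x|) * `|y - x| = n%:R * L2 * `|y - x| ^+ 2 by ring.
  by rewrite ler_wpM2r ?sqr_ge0 // /L; lra.
Qed.

End VectorFields.

(** * Estimates for a local flow near a point, and its Jacobian *)

Section Flow.
Variables (R : realType) (n : nat) (Y : 'cV[R]_n -> 'cV[R]_n).

(** [e] limits times and starting points; [r] is the radius of a ball that the trajectories then do
    not leave and on which [Y] is controlled by [L]. The flow domain no longer appears. *)
Record flow_near (G : R -> 'cV[R]_n -> 'cV[R]_n) (x0 : 'cV[R]_n) (e r L : R) :
    Prop := FlowNear {
  flow_near_gt0 : 0 < e;
  flow_near_ge0 : 0 <= L;
  flow_near0 : forall x, `|x - x0| < e -> G 0 x = x;
  flow_near_derive : forall (t : R) x, `|t| < e -> `|x - x0| < e ->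
    is_derive t 1 (G^~ x) (Y (G t x));
  flow_near_dist : forall t x, `|t| < e -> `|x - x0| < e ->
    `|G t x - x| <= L * `|t|;
  flow_near_ball : forall t x, `|t| < e -> `|x - x0| < e -> `|G t x - x0| < r;
  flow_near_lip : forall x y, `|x - x0| < r -> `|y - x0| < r ->
    `|Y x - Y y| <= L * `|x - y|;
  flow_near_jac : forall x, `|x - x0| < r -> `|jac Y x| <= L;
  flow_near_taylor : forall x y, `|x - x0| < r -> `|y - x0| < r ->
    `|Y y - Y x - jac Y x *m (y - x)| <= L * `|y - x| ^+ 2 }.

(** The speed is bounded only within distance [rho] of the start. At a first time of reaching [rho]
    the bound would still give a distance of at most [B], which is less than [rho]. *)
Lemma first_exit (c dc : R -> 'cV[R]_n) (rho B : R) :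
  (forall s : R, 0 <= s <= 1 -> is_derive s 1 c (dc s)) ->
  (forall s, 0 <= s <= 1 -> `|c s - c 0| < rho -> `|dc s| <= B) ->
  0 < rho -> 0 <= B < rho ->
  forall s, 0 <= s <= 1 -> `|c s - c 0| <= B * s.
Proof.
move=> cd dcB rho0 /andP[B0 Brho].
pose phi s := `|c s - c 0|.
have phic s : {for s, continuous (phi \o @clamp01 R)}.
  apply: (continuous_comp (@continuous_clamp01 R s)).
  apply: (continuous_comp _ (@norm_continuous _ _ _)).
  apply: continuousB; last exact: cst_continuous.
  exact: is_derive1_continuous (cd _ (clamp01_itv s)).
have stay s : 0 <= s <= 1 -> (forall t, 0 <= t <= 1 -> t < s -> phi t < rho) ->
    phi s <= B * s.
  move=> s01 before; have [s0 s1] := andP s01; rewrite /phi.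
  have -> : B * s = B * (s - 0) by rewrite subr0.
  apply: (@mean_value_mx _ _ _ c dc) => // t ts.
    by apply: cd; lra.
  by apply: dcB; [lra|apply: before; lra].
have inside s : 0 <= s <= 1 -> phi s < rho.
  move=> s01; rewrite ltNge; apply/negP => rhos.
  (* The times at distance at least [rho] form a compact set, whose least element is the first
     exit. *)
  pose A := `[0, 1]%classic `&` (phi \o @clamp01 R) @^-1` [set y | rho <= y].
  have Acpt : compact A.
    apply: compact_closedI; first exact: segment_compact.
    apply: closed_comp; last exact: closed_ge.
    by move=> y _; exact: phic.
  have [|x] := @compact_EVT_min R R id A _ Acpt (continuous_subspaceT (fun=> cvg_id)).
    by exists s; split; [rewrite /= in_itv|rewrite /= clamp01_id].
  rewrite inE => -[/= /[!in_itv]/= x01]; rewrite clamp01_id // => rhox minx.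
  have [x0 x1] := andP x01.
  have := stay x x01; rewrite leNgt => /(_ _)/negP[].
    move=> t t01 tx; rewrite ltNge; apply/negP => rhot.
    have : x <= t by apply: minx; rewrite inE; split; rewrite /= ?in_itv ?clamp01_id.
    by rewrite leNgt tx.
  by apply: lt_le_trans rhox; apply: le_lt_trans Brho; rewrite ler_piMr.
by move=> s s01; apply: stay => // t t01 _; exact: inside.
Qed.

Lemma flow_near_exists D G x0 : smooth_on setT Y -> local_flow Y D G ->
  D (0, x0) -> exists e r L, flow_near G x0 e r L.
Proof.
move=> Ys [Do Dstar G0 Gd] Dx0.
have [r [L [r0 L0 Ybd Ylip Ytay]]] := field_estimates x0 Ys.
have /= := open_nbhs_nbhs (conj Do Dx0).
move=> [[A B] [/= /nbhs_normP[e1 /= e10 He1] /nbhs_normP[e2 /= e20 He2]] AB].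
(* Starting within [r / 2] of [x0] and moving with speed at most [L] for a time below [e], a
   trajectory travels less than [r / 2] and stays in the ball of radius [r]. *)
pose e := Num.min (Num.min e1 e2) (r / (2 * (L + 1))).
have L10 : 0 < 2 * (L + 1) by lra.
have e0 : 0 < e by rewrite !lt_min e10 e20 divr_gt0.
have ee1 : e <= e1 by rewrite !ge_min lexx.
have ee2 : e <= e2 by rewrite !ge_min lexx !orbT.
have er : e * (2 * (L + 1)) <= r by rewrite -ler_pdivlMr // !ge_min lexx !orbT.
have eL0 : 0 <= e * L by rewrite mulr_ge0 // ltW.
have Dtx t x : `|t| < e -> `|x - x0| < e -> D (t, x).
  move=> te xe; apply: AB; split=> /=.
    by apply: He1; rewrite /= sub0r normrN (lt_le_trans te).
  by apply: He2; rewrite /= distrC (lt_le_trans xe).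
have norm00 : `|0 : R| < e by rewrite normr0.
have G00 x : `|x - x0| < e -> G 0 x = x by move=> xe; exact/G0/Dtx.
have dist t x s : `|t| < e -> `|x - x0| < e -> 0 <= s <= 1 ->
    `|G (t * s) x - x| <= L * `|t| * s.
  move=> te xe s01.
  have cd (u : R) : 0 <= u <= 1 ->
      is_derive u 1 (fun u => G (t * u) x) (t *: Y (G (t * u) x)).
    move=> /andP[u0 u1]; apply: (@is_derive_scale_arg R _ (G^~ x) t u).
    by apply/Gd/Dtx => //; rewrite normrM (le_lt_trans _ te) // ler_piMr // ger0_norm.
  have Lt : 0 <= L * `|t| < r / 2.
    rewrite mulr_ge0 //=; have : L * `|t| <= L * e by rewrite ler_wpM2l // ltW.
    by nra.
  have r20 : 0 < r / 2 by lra.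
  have := first_exit cd _ r20 Lt s01; rewrite mulr0 G00 //; apply => u u01 ux.
  rewrite normrZ mulrC ler_wpM2r //; apply: (Ybd _ _).1.
  rewrite -(subrKA x); apply: le_lt_trans (ler_normD _ _) _.
  by nra.
have dist1 t x : `|t| < e -> `|x - x0| < e -> `|G t x - x| <= L * `|t|.
  by move=> te xe; have := dist t x 1 te xe; rewrite !mulr1; apply; rewrite ler01 lexx.
exists e, r, L; split=> //.
- by move=> t x te xe; apply/Gd/Dtx.
- move=> t x te xe; rewrite -(subrKA x); apply: le_lt_trans (ler_normD _ _) _.
  have := dist1 t x te xe.
  have : L * `|t| <= L * e by rewrite ler_wpM2l // ltW.
  by nra.
- by move=> x /Ybd[].
Qed.

Section FlowNear.
Variables (G : R -> 'cV[R]_n -> 'cV[R]_n) (x0 : 'cV[R]_n) (e r L : R).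
Hypothesis Gn : flow_near G x0 e r L.

Lemma flow_near_path (t s : R) x : `|t| < e -> 0 <= s <= 1 -> `|x - x0| < e ->
  is_derive s 1 (fun s => G (t * s) x) (t *: Y (G (t * s) x)) /\
  `|G (t * s) x - x0| < r.
Proof.
move=> te /andP[s0 s1] xe.
have tse : `|t * s| < e by rewrite normrM (le_lt_trans _ te) // ler_piMr // ger0_norm.
split; last exact: flow_near_ball Gn _ _ tse xe.
apply: (@is_derive_scale_arg R _ (G^~ x) t s).
exact: flow_near_derive Gn _ _ tse xe.
Qed.

(* Uniqueness: both sides solve [c' = - t Y(c)] with the same initial point. *)
Lemma flow_near_back t x s : `|t| < e -> `|x - x0| < e -> `|G t x - x0| < e ->
  0 <= s <= 1 -> G (- t * s) (G t x) = G (t * (1 - s)) x.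
Proof.
move=> te xe ye s01.
have Nte : `|- t| < e by rewrite normrN.
have e0 := flow_near_gt0 Gn.
have L0 := flow_near_ge0 Gn.
pose u s := G (- t * s) (G t x) - G (t * (1 - s)) x.
pose du s := - t *: (Y (G (- t * s) (G t x)) - Y (G (t * (1 - s)) x)).
have rev01 (s' : R) : 0 <= s' <= 1 -> 0 <= 1 - s' <= 1 by lra.
have [|K K0 HK] := @gronwall R n 1 (e * L); first by rewrite mulr_ge0 // ltW.
apply/eqP; rewrite -subr_eq0 -normr_le0 -[leRHS](mulr0 K).
apply: (HK u du 0) => //.
- rewrite /u mulr0 subr0 mulr1 (flow_near0 Gn ye) subrr normr0 //.
- move=> t' t01.
  have [h1 _] := flow_near_path Nte t01 ye.
  have [h2 _] := flow_near_path te (rev01 _ t01) xe.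
  have h3 : is_derive t' 1 (fun s => G (t * (1 - s)) x) (- t *: Y (G (t * (1 - t')) x)).
    have := (@is_derive_line R R _ (fun s => G (t * s) x) 1 (-1) t'
      (- t *: Y (G (t * (1 - t')) x))).
    rewrite (_ : (fun _ => G (t * (1 + _ *: -1)) x) = (fun s => G (t * (1 - s)) x)); last first.
      by apply/funext => s'; rewrite /GRing.scale/= mulrN1.
    apply.
    rewrite /GRing.scale/= mulrN1.
    have [gd gE] := h2.
    have gdiff := (derivable1_diffP _ _).1 gd.
    split; first exact: diff_derivable.
    by rewrite deriveE // linearN -deriveE // gE -scaleNr.
  by apply: is_derive_eq; rewrite /du scalerBr.
- move=> t' t01; rewrite addr0 /du normrZ normrN -mulrA.
  have [_ h1] := flow_near_path Nte t01 ye.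
  have [_ h2] := flow_near_path te (rev01 _ t01) xe.
  apply: ler_pM => //; first exact: ltW.
  exact: flow_near_lip Gn _ _ h1 h2.
Qed.

(** Gronwall's inequality is used twice: neighbouring trajectories differ by O(h), so the Taylor
    remainder of [Y] between them is O(h^2), and so is the error of the linearisation. Coordinate
    directions suffice, [jac] being made of partial derivatives. *)
Lemma flow_near_jac_ode t y : smooth_on setT Y -> `|t| < e -> `|y - x0| < e ->
  exists J : R -> 'M[R]_n, [/\ J 0 = 1%:M, J 1 \in unitmx,
    forall s : R, 0 <= s <= 1 ->
      is_derive s 1 J ((t *: jac Y (G (t * s) y)) *m J s) &
    jac (G t) y = J 1].
Proof.
move=> Ys te ye.
have e0 := flow_near_gt0 Gn; have L0 := flow_near_ge0 Gn.
pose c s := G (t * s) y.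
pose P s := t *: jac Y (c s).
have Pc (s : R) : 0 <= s <= 1 -> {for s, continuous P}.
  move=> s01; apply: continuousZr.
  have [cd _] := flow_near_path te s01 ye.
  apply: (continuous_comp (is_derive1_continuous cd)).
  exact: differentiable_continuous (smooth_on_differentiable (smooth_on_jac Ys) I).
have [J [J0 Ju Jd]] := fundamental_matrix Pc.
exists J; split=> //.
have [|K1 K10 HK1] := @gronwall R n 1 (e * L); first by rewrite mulr_ge0 // ltW.
have [|K2 K20 HK2] := @gronwall R n 1 (e * (n%:R * L)).
  by rewrite !mulr_ge0 // ltW.
(* [e] bounds the time, [L * K1 ^+ 2] the Taylor remainder per [h ^+ 2], and [K2] is the Gronwall
   factor for [rem]. *)
pose B := K2 * (e * (L * K1 ^+ 2)).
have B0 : 0 <= B by rewrite !mulr_ge0 ?sqr_ge0 // ltW.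
have s11 : 0 <= (1 : R) <= 1.
  by rewrite ler01 lexx.
have bound j : \forall h \near (0 : R),
    `|G t (y + h *: delta_mx j 0) - G t y - h *: (J 1 *m delta_mx j 0)| <= B * h ^+ 2.
  pose v : 'cV[R]_n := delta_mx j 0.
  have v1 : `|v| <= 1.
    by apply: mx_norm_le => // a b; rewrite mxE; case: (_ && _); rewrite ?normr1 ?normr0.
  have : \forall h \near (0 : R), `|h| < e - `|y - x0|.
    apply/nbhs_normP; exists (e - `|y - x0|); first by rewrite /= subr_gt0.
    by move=> h; rewrite /= sub0r normrN.
  apply: filterS => h he.
  have hv : `|h *: v| <= `|h| by rewrite normrZ ler_piMr.
  have yhe : `|y + h *: v - x0| < e.
    rewrite addrAC; apply: le_lt_trans (ler_normD _ _) _; lra.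
  pose ch s := G (t * s) (y + h *: v).
  have dlt s : 0 <= s <= 1 -> `|ch s - c s| <= K1 * `|h|.
    apply: (HK1 (fun s => ch s - c s) (fun s => t *: (Y (ch s) - Y (c s)))) => //.
    - rewrite /ch /c mulr0 (flow_near0 Gn yhe) (flow_near0 Gn ye).
      by rewrite addrC addKr.
    - move=> u u01.
      have [h1 _] := flow_near_path te u01 yhe.
      have [h2 _] := flow_near_path te u01 ye.
      by apply: is_derive_eq; rewrite scalerBr.
    - move=> u u01.
      have [_ h1] := flow_near_path te u01 yhe.
      have [_ h2] := flow_near_path te u01 ye.
      rewrite normrZ -mulrA; apply: (@le_trans _ _ (e * (L * `|ch u - c u|))).
        apply: ler_pM => //; first exact: ltW.
        exact: flow_near_lip Gn _ _ h1 h2.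
      by rewrite lerDl.
  pose rem s := ch s - c s - h *: (J s *m v).
  pose tay s := Y (ch s) - Y (c s) - jac Y (c s) *m (ch s - c s).
  (* [rem] solves the linearised equation with source [t *: tay s], and starts at 0 because [J 0] is
     the identity. *)
  pose drem s := t *: tay s + P s *m rem s.
  have /(_ 1 s11) : forall s : R, 0 <= s <= 1 ->
      `|rem s| <= K2 * (e * (L * K1 ^+ 2) * h ^+ 2).
    have q0 : 0 <= e * (L * K1 ^+ 2) * h ^+ 2.
      by rewrite mulr_ge0 ?sqr_ge0 // mulr_ge0 ?(ltW e0) // mulr_ge0 // sqr_ge0.
    apply: (HK2 rem drem) => //.
    - rewrite /rem /ch /c mulr0 (flow_near0 Gn yhe) (flow_near0 Gn ye).
      rewrite J0 mul1mx [y + _]addrC addrK subrr normr0.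
      exact: q0.
    - move=> u u01.
      have [h1 _] := flow_near_path te u01 yhe.
      have [h2 _] := flow_near_path te u01 ye.
      have h3 := is_derive_mulmx (Jd u u01) (is_derive_cst v u 1).
      have E : jac Y (c u) *m rem u =
          jac Y (c u) *m (ch u - c u) - h *: (jac Y (c u) *m (J u *m v)).
        by rewrite /rem mulmxBr -scalemxAr.
      apply: is_derive_eq.
      rewrite mulmx0 addr0 /drem /tay /P -!scalemxAl E -mulmxA -/(c u) -/(ch u).
      set a := jac Y (c u) *m _; set b := jac Y (c u) *m _.
      by apply/matrixP => k l; rewrite !mxE; ring.
    - move=> u u01.
      have [_ h1] := flow_near_path te u01 yhe.
      have [_ h2] := flow_near_path te u01 ye.
      rewrite /drem addrC; apply: le_trans (ler_normD _ _) _; apply: lerD.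
        apply: le_trans (mx_norm_mul _ _) _.
        rewrite ler_wpM2r // [leRHS]mulrCA ler_wpM2l // normrZ ler_pM // ?(ltW te) //.
        exact: flow_near_jac Gn _ h2.
      rewrite normrZ -mulrA ler_pM // ?(ltW te) //.
      apply: le_trans (flow_near_taylor Gn h2 h1) _.
      rewrite -mulrA ler_wpM2l // -[h ^+ 2]real_normK ?num_real // -exprMn.
      by rewrite ler_sqr ?nnegrE ?mulr_ge0 // ?(ltW K10) // dlt.
  by rewrite /rem /ch /c mulr1 mulrA.
apply/matrixP => i j; rewrite mxE.
suff h : is_derive y (delta_mx j 0) (G t) (J 1 *m delta_mx j 0).
  have [_ ->] := h; rewrite mxE (bigD1 j) //= big1 ?addr0; last first.
    by move=> k kj; rewrite mxE (negbTE kj) mulr0.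
  by rewrite mxE !eqxx mulr1.
have lim : h^-1 *: ((G t \o shift y) (h *: delta_mx j 0) - G t y) @[h --> 0^'] -->
    J 1 *m delta_mx j 0.
  apply/cvgrPdist_le => d d0.
  have B10 : 0 < B + 1 by lra.
  have small : \forall h \near 0^', `|h : R| <= d / (B + 1).
    by apply: dnbhs0_le; rewrite divr_gt0.
  near=> h.
  have h0 : h != 0 by near: h; exact: nbhs_dnbhs_neq.
  have hd : `|h| <= d / (B + 1) by near: h.
  have hB : `|G t (y + h *: delta_mx j 0) - G t y - h *: (J 1 *m delta_mx j 0)| <= B * h ^+ 2.
    by near: h; apply: nbhs_dnbhs; exact: bound.
  rewrite distrC /= [h *: _ + y]addrC.
  set w := J 1 *m _ in hB *.
  have -> : w = h^-1 *: (h *: w) by rewrite scalerA mulVf // scale1r.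
  rewrite -scalerBr normrZ normfV ler_pdivrMl ?normr_gt0 //.
  apply: le_trans hB _.
  rewrite -real_normK ?num_real // expr2 mulrCA ler_wpM2l //.
  move: hd; rewrite ler_pdivlMr // mulrDr mulr1 => hd.
  have := normr_ge0 h; lra.
by split; [apply/cvg_ex; exists (J 1 *m delta_mx j 0)|exact/cvg_lim].
Unshelve. all: by end_near. Qed.

End FlowNear.
End Flow.

(** * Orbits and transported fields *)

Section Orbit.
Variables (R : realType) (n M : nat).
Variables (G : 'I_M -> R -> 'cV[R]_n -> 'cV[R]_n) (x0 : 'cV[R]_n).
Implicit Types p q : 'rV[R]_M.

Lemma orbit_fromS p (i : 'I_M) :
  orbit_from G x0 p i = G i (p 0 i) (orbit_from G x0 p i.+1).
Proof.
by rewrite /orbit_from (drop_nth i) ?size_enum_ord //= nth_ord_enum.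
Qed.

Lemma orbit_from_end p k : (M <= k)%N -> orbit_from G x0 p k = x0.
Proof. by move=> Mk; rewrite /orbit_from drop_oversize // size_enum_ord. Qed.

Lemma back_ptS p z (i : 'I_M) :
  back_pt G p z i.+1 = G i (- p 0 i) (back_pt G p z i).
Proof.
rewrite /back_pt (take_nth i) ?size_enum_ord // -cats1 foldl_cat /=.
by rewrite nth_ord_enum.
Qed.

(** Descending induction: an orbit is composed from the innermost flow, the one of largest index,
    outwards. *)
Lemma orbit_from_ind (P : nat -> Prop) : P M ->
  (forall i : 'I_M, P i.+1 -> P i) -> forall k, (k <= M)%N -> P k.
Proof.
move=> PM PS k kM.
have PMd d : (d <= M)%N -> P (M - d)%N.
  elim: d => [|d IH] dM; first by rewrite subn0.
  have iM : (M - d.+1 < M)%N by rewrite ltn_subrL (leq_trans _ dM).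
  by apply: (PS (Ordinal iM)); rewrite /= subnSK //; exact/IH/ltnW.
by rewrite -(subKn kM); apply: PMd; exact: leq_subr.
Qed.

Lemma orbit_from_eq p q k : (k <= M)%N ->
  (forall j : 'I_M, (k <= j)%N -> p 0 j = q 0 j) ->
  orbit_from G x0 p k = orbit_from G x0 q k.
Proof.
move: k; apply: orbit_from_ind => [_|i IH pq]; first by rewrite !orbit_from_end.
rewrite !orbit_fromS pq // IH // => j ij; exact/pq/ltnW.
Qed.

(** The bound on the displacement by each flow takes the place of continuity of the orbit map. *)
Lemma orbit_from_near (Y : 'I_M -> 'cV[R]_n -> 'cV[R]_n) (e r L : 'I_M -> R) :
  (forall i, flow_near (Y i) (G i) x0 (e i) (r i) (L i)) ->
  forall k, (k <= M)%N -> forall d : R, 0 < d ->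
  \forall p \near (0 : 'rV[R]_M), `|orbit_from G x0 p k - x0| < d.
Proof.
move=> Gn; apply: orbit_from_ind => [d d0|i IH d d0].
  by near=> p; rewrite orbit_from_end // subrr normr0.
have e0 := flow_near_gt0 (Gn i); have L0 := flow_near_ge0 (Gn i).
have d20 : 0 < d / 2 by rewrite divr_gt0.
pose d1 := Num.min (d / 2) (e i).
have d10 : 0 < d1 by rewrite lt_min d20.
have L1 : 0 < L i + 1 by lra.
pose d2 := Num.min (e i) (d / 2 / (L i + 1)).
have d20' : 0 < d2 by rewrite lt_min e0 divr_gt0.
have near_p : \forall p \near (0 : 'rV[R]_M), `|p| < d2.
  by apply/nbhs_normP; exists d2 => // p; rewrite /= sub0r normrN.
have near_z := IH d1 d10.
near=> p.
have zd : `|orbit_from G x0 p i.+1 - x0| < d1 by near: p.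
have pd : `|p 0 i| < d2.
  by apply: le_lt_trans (mx_norm_coord _ _ _) _; near: p.
move: zd pd; rewrite !lt_min => /andP[z1 z2] /andP[p1 p2].
rewrite orbit_fromS -(subrKA (orbit_from G x0 p i.+1)).
apply: le_lt_trans (ler_normD _ _) _.
have h := flow_near_dist (Gn i) p1 z2.
move: p2; rewrite ltr_pdivlMr // mulrDr mulr1 => p2.
have := normr_ge0 (p 0 i).
rewrite mulrC in h; lra.
Unshelve. all: by end_near. Qed.

(** The change of times is expressed by factors of absolute value at most 1: the scaled point stays
    in every box, for all real [s] thanks to the clamp, and depends linearly on [p]. *)
Definition scale_coord (i j : 'I_M) (s : R) : R :=
  if (j < i)%N then 0 else if j == i then 1 - clamp01 s else 1.

Definition scale_point (i : 'I_M) (s : R) p : 'rV[R]_M :=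
  \row_j (scale_coord i j s * p 0 j).

Lemma continuous_scale_coord i j : continuous (scale_coord i j).
Proof.
rewrite /scale_coord; case: (j < i)%N; first exact: cst_continuous.
case: (j == i); last exact: cst_continuous.
move=> s; apply: continuousB; first exact: cst_continuous.
exact: continuous_clamp01.
Qed.

Lemma norm_scale_coord i j s : `|scale_coord i j s| <= 1.
Proof.
rewrite /scale_coord; case: ifP => _; first by rewrite normr0.
case: ifP => _; last by rewrite normr1.
by have := clamp01_itv s => h; rewrite ger0_norm; lra.
Qed.

Lemma box_scale_point (a : 'I_M -> R) i s p :
  box a p -> box a (scale_point i s p).
Proof.
move=> pa j; rewrite -ltr_norml mxE normrM.
apply: le_lt_trans (_ : `|p 0 j| < _); last by rewrite ltr_norml.
by rewrite ler_piMl // norm_scale_coord.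
Qed.

Variables (Y : 'I_M -> 'cV[R]_n -> 'cV[R]_n) (D : 'I_M -> set (R * 'cV[R]_n)).
Variable a : 'I_M -> R.
Hypothesis flowG : forall i, local_flow (Y i) (D i) (G i).
Hypothesis defG : orbit_defined D G x0 a.

(** At time 0 each leading flow is the identity, since [orbit_defined] puts time 0 and the current
    point in its domain. *)
Lemma orbit_skip p k : box a p -> (k <= M)%N ->
  (forall j : 'I_M, (j < k)%N -> p 0 j = 0) -> orbit_pt G x0 p = orbit_from G x0 p k.
Proof.
move=> pa; elim: k => [//|k IH] kM p0.
rewrite IH ?(ltnW kM) //; last by move=> j jk; exact/p0/ltnW.
have Dk := defG.2 p pa (Ordinal kM); have [_ _ G0 _] := flowG (Ordinal kM).
by rewrite (orbit_fromS p (Ordinal kM)) p0 //= G0 // -(p0 (Ordinal kM)).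
Qed.

Lemma box0 : box a 0.
Proof. by move=> i; rewrite mxE oppr_lt0 defG.1. Qed.

Lemma orbit_from0 k : orbit_from G x0 0 k = x0.
Proof.
have [kM|/ltnW] := leqP k M; last exact: orbit_from_end.
have zero k' (j : 'I_M) : (j < k')%N -> (0 : 'rV[R]_M) 0 j = 0 by rewrite mxE.
by rewrite -(orbit_skip box0 kM (zero k)) (orbit_skip box0 (leqnn M) (zero M)) orbit_from_end.
Qed.

Lemma orbit_scale_point p i s : box a p ->
  orbit_pt G x0 (scale_point i s p) =
  G i (p 0 i * (1 - clamp01 s)) (orbit_from G x0 p i.+1).
Proof.
move=> pa; have spa := box_scale_point i s pa.
rewrite (@orbit_skip _ i spa (ltnW (ltn_ord i))); last first.
  by move=> j ji; rewrite mxE /scale_coord ji mul0r.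
rewrite orbit_fromS mxE /scale_coord ltnn eqxx mulrC; congr (G i _ _).
apply: orbit_from_eq => // j ij.
rewrite mxE /scale_coord ltnNge (ltnW ij) /= ifN ?mul1r //.
by rewrite -val_eqE /= gtn_eqF.
Qed.

Lemma flow_near_all : (forall i, smooth_on setT (Y i)) ->
  exists e r L : 'I_M -> R, forall i, flow_near (Y i) (G i) x0 (e i) (r i) (L i).
Proof.
move=> Ys.
have /choice[erL HerL] : forall i, exists erL : R * R * R,
    flow_near (Y i) (G i) x0 erL.1.1 erL.1.2 erL.2.
  move=> i; have := defG.2 0 box0 i; rewrite orbit_from0 mxE => Di.
  have [e [r [L H]]] := flow_near_exists (Ys i) (flowG i) Di.
  by exists (e, r, L).
by exists (fun i => (erL i).1.1), (fun i => (erL i).1.2), (fun i => (erL i).2).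
Qed.

End Orbit.

(** The noncommutative product as a monoid law, so that [bigmx_ltS] can split off the last
    factor. *)
HB.instance Definition _ (R : pzRingType) n :=
  Monoid.isLaw.Build 'M[R]_n 1%:M mulmx (@mulmxA R n n n n) (@mul1mx R n n)
    (@mulmx1 R n n).

(** * Transport of the generators along the orbit *)

Section Transport.
Variables (R : realType) (n M : nat).
Variables (Y : 'I_M -> 'cV[R]_n -> 'cV[R]_n) (D : 'I_M -> set (R * 'cV[R]_n)).
Variables (G : 'I_M -> R -> 'cV[R]_n -> 'cV[R]_n) (x0 : 'cV[R]_n).
Variables (a : 'I_M -> R) (e r L : 'I_M -> R).
Hypothesis flowG : forall i, local_flow (Y i) (D i) (G i).
Hypothesis defG : orbit_defined D G x0 a.
Hypothesis Ys : forall i, smooth_on setT (Y i).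
Hypothesis Gn : forall i, flow_near (Y i) (G i) x0 (e i) (r i) (L i).
Variable b : 'I_M -> 'I_M -> 'I_M -> 'rV[R]_M -> R.
Hypothesis bs : forall i j l, smooth_on (box a) (b i j l).
Hypothesis bE : forall i j p, box a p ->
  lie_bracket (Y i) (Y j) (orbit_pt G x0 p) =
  \sum_l b i j l p *: Y l (orbit_pt G x0 p).
Variable U : set 'rV[R]_M.
Hypothesis Uo : open U.
Hypothesis Ua : U `<=` box a.

(** Both ends of each piece are kept close to [x0]: the flow is run forward from the point of index
    [i.+1] and backward from that of index [i]. *)
Definition near_orbit (p : 'rV[R]_M) := forall i : 'I_M,
  [/\ `|p 0 i| < e i, `|orbit_from G x0 p i - x0| < e i &
      `|orbit_from G x0 p i.+1 - x0| < e i].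
Hypothesis Un : forall p, U p -> near_orbit p.

Lemma transport_step (i : 'I_M) : exists Psi : 'rV[R]_M -> 'M[R]_M,
  [/\ forall k u v, Ck_family k U (fun _ p => Psi p u v),
      U 0 -> Psi 0 = 1%:M &
      forall p, U p ->
        flow_Hinv (G i) (- p 0 i) (orbit_from G x0 p i) *m
          cols Y (orbit_from G x0 p i.+1) =
        cols Y (orbit_from G x0 p i) *m Psi p].
Proof.
have s11 : 0 <= (1 : R) <= 1 by rewrite ler01 lexx.
(* The derivative of [Y j] along the backward curve is -t_i (DY_j) Y_i, that is -t_i (DY_i) Y_j -
   t_i [Y_i, Y_j]; the second term, expanded in the generators, gives column [j] of [C]. *)
pose C (s : R) (p : 'rV[R]_M) : 'M[R]_M := \matrix_(l, j) (- p 0 i * b i j l (scale_point i s p)).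
have Ck k l j : Ck_family k U (fun s p => C s p l j).
  have h1 := Ck_familyM Uo (Ck_family_time Uo k (@cst_continuous R R (-1)))
    (Ck_family_coord k i Uo).
  have h2 : Ck_family k U (fun s p => b i j l (scale_point i s p)).
    apply: (Ck_family_scale k Uo _ _ (bs i j l)).
      by move=> j'; exact: continuous_scale_coord.
    by move=> s q Uq; apply: box_scale_point; exact: Ua.
  apply: Ck_family_eq (Ck_familyM Uo h1 h2) => // s p _.
  by rewrite mxE mulN1r.
have /choice[x xsol] : forall u : 'I_M, exists x, solves U C (row u 1%:M) x.
  by move=> u; apply: solves_exists => l j; exact: Ck.
pose X (s : R) (p : 'rV[R]_M) : 'M[R]_M := \matrix_(u, v) x u s p 0 v.
have Cc p (s : R) : U p -> {for s, continuous (C^~ p)}.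
  move=> Up; apply/continuous_mxP => l j.
  apply: (@joint_continuousl R _ R (fun s q => C s q l j)).
  exact: (Ck 0%N l j).1.
have X0 p : U p -> X 0 p = 1%:M.
  by move=> Up; apply/matrixP => u v; rewrite mxE (xsol u p Up).1 mxE.
have Xd p (s : R) : U p -> 0 <= s <= 1 -> is_derive s 1 (X^~ p) (X s p *m C s p).
  move=> Up s01; apply/is_derive_mxP => u v.
  have /is_derive_mxP/(_ 0 v) := (xsol u p Up).2 s s01.
  rewrite (_ : (fun s => X s p u v) = (fun s => x u s p 0 v)); last first.
    by apply/funext => t; rewrite mxE.
  rewrite !mxE; congr (is_derive _ _ _ _).
  by apply: eq_bigr => l _; congr (_ * _); rewrite mxE.
(* At time 1 the backward curve has reached the next orbit point. *)
exists (X 1); split.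
- move=> k u v.
  have := solution_Ck Uo (Ck k) (xsol u) 0 v => /(Ck_family_freeze 1).
  apply: Ck_family_eq => // s p _.
  by rewrite mxE clamp01_id.
(* At [p = 0] the factor [p 0 i] kills [C], so [X] remains the identity; this is the origin of A(0)
   = I. *)
- move=> U0; apply/eqP; rewrite -subr_eq0; apply/eqP.
  apply: (@linear_ode_unique0 R M M (fun=> 0) (C^~ 0) (fun s => X s 0 - 1%:M)) => //.
  + by move=> s _; exact: cst_continuous.
  + by move=> s _; exact: Cc.
  + move=> s s01; have h := Xd 0 s U0 s01.
    have C0 : C s 0 = 0 by apply/matrixP => l j; rewrite !mxE oppr0 mul0r.
    by apply: is_derive_eq; rewrite C0 !mulmx0 mul0mx addr0 subr0.
  + by rewrite X0 // subrr.
- move=> p Up; have [te ye ze] := Un Up i.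
  pose t := p 0 i; pose y := orbit_from G x0 p i; pose z := orbit_from G x0 p i.+1.
  have yE : y = G i t z by exact: orbit_fromS.
  have Nte : `|- t| < e i by rewrite normrN.
  have [J [J0 Ju Jd JE]] := flow_near_jac_ode (Gn i) (Ys i) Nte ye.
  pose c s := G i (- t * s) y.
  have cE s : 0 <= s <= 1 -> c s = orbit_pt G x0 (scale_point i s p).
    move=> s01; rewrite (orbit_scale_point flowG defG i s (Ua Up)) clamp01_id //.
    by have := flow_near_back (Gn i) te ze _ s01; rewrite -orbit_fromS; exact.
  have cd (s : R) : 0 <= s <= 1 -> is_derive s 1 c (- t *: Y i (c s)).
    by move=> s01; have [] := flow_near_path (Gn i) Nte s01 ye.
  have Yd (s : R) : 0 <= s <= 1 -> is_derive s 1 (fun s => cols Y (c s))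
      ((- t *: jac (Y i) (c s)) *m cols Y (c s) + cols Y (c s) *m C s p).
    move=> s01; apply/is_derive_mxP => k j.
    rewrite (_ : (fun _ => _) = fun s => (Y j \o c) s k 0); last first.
      by apply/funext => u; rewrite mxE.
    have Yjd : differentiable (Y j) (c s).
      exact: smooth_on_differentiable (Ys j) I.
    have /is_derive_mxP/(_ k 0) := is_derive_comp1 (cd s s01) Yjd.
    rewrite derive_jac // => h; apply: is_derive_eq.
    rewrite -scalemxAr mxE -scalemxAl [in RHS]mxE [X in _ = X + _]mxE.
    have jacE : (jac (Y i) (c s) *m cols Y (c s)) k j = (jac (Y i) (c s) *m Y j (c s)) k 0.
      by rewrite [LHS]mxE [RHS]mxE; apply: eq_bigr => l _; congr (_ * _); rewrite mxE.
    rewrite jacE.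
    have := bE i j (box_scale_point i s (Ua Up)); rewrite -cE // /lie_bracket.
    move=> /matrixP/(_ k 0); rewrite summxE.
    set u := jac (Y j) _ *m _; set v := jac (Y i) _ *m _.
    rewrite mxE [X in _ + X]mxE => h1.
    have -> : (cols Y (c s) *m C s p) k j =
        - t * \sum_l (b i j l (scale_point i s p) *: Y l (c s)) k 0.
      rewrite mxE mulr_sumr; apply: eq_bigr => l _.
      by rewrite !mxE -/t; ring.
    by rewrite -h1; ring.
  have Pc (s : R) : 0 <= s <= 1 -> {for s, continuous (fun s => - t *: jac (Y i) (c s))}.
    move=> s01; apply: continuousZr.
    apply: (continuous_comp (is_derive1_continuous (cd s s01))).
    exact: differentiable_continuous (smooth_on_differentiable (smooth_on_jac (Ys i)) I).
  have key (s : R) : 0 <= s <= 1 ->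
      cols Y (c s) - J s *m (cols Y y *m X s p) = 0.
    apply: (@linear_ode_unique0 R n M (fun s => - t *: jac (Y i) (c s)) (C^~ p)
      (fun s => cols Y (c s) - J s *m (cols Y y *m X s p))) => //.
    + by move=> u _; exact: Cc.
    + move=> u u01.
      have h1 := Yd u u01.
      have h2 := is_derive_mulmx (is_derive_cst (cols Y y) u 1) (Xd p u Up u01).
      have h3 := is_derive_mulmx (Jd u u01) h2.
      apply: is_derive_eq; rewrite mul0mx add0r mulmxBr mulmxBl !mulmxA.
      by rewrite opprD addrACA.
    + rewrite J0 X0 // mul1mx mulmx1 /c mulr0 (flow_near0 (Gn i) ye).
      by rewrite subrr.
  have c1 : c 1 = z.
    by rewrite cE // (orbit_scale_point flowG defG i 1 (Ua Up)) clamp01_id // subrr mulr0 (flow_near0 (Gn i) ze).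
  have /eqP := key 1 s11; rewrite subr_eq0 c1 => /eqP ->.
  by rewrite /flow_Hinv JE mulmxA mulVmx // mul1mx.
Qed.

(** [flow_near_back] at [s = 1] cancels the outermost remaining flow, so the backward points retrace
    the orbit. *)
Lemma back_pt_orbit p k : U p -> (k <= M)%N ->
  back_pt G p (orbit_pt G x0 p) k = orbit_from G x0 p k.
Proof.
move=> Up; elim: k => [|k IH] kM; first by rewrite /back_pt take0.
have [te ye ze] := Un Up (Ordinal kM).
rewrite (back_ptS G p _ (Ordinal kM)) IH ?(ltnW kM) //=.
have yE := orbit_fromS G x0 p (Ordinal kM); rewrite /= in yE.
have s11 : 0 <= (1 : R) <= 1 by rewrite ler01 lexx.
rewrite yE -[- p 0 _]mulr1 (flow_near_back (Gn (Ordinal kM)) te ze _ s11) -?yE //.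
by rewrite subrr mulr0 (flow_near0 (Gn (Ordinal kM)) ze).
Qed.

Lemma bigmx_ltS m (F : 'I_M -> 'M[R]_m) k (kM : (k < M)%N) :
  \big[mulmx/1%:M]_(i < M | (i < k.+1)%N) F i =
  \big[mulmx/1%:M]_(i < M | (i < k)%N) F i *m F (Ordinal kM).
Proof.
rewrite (big_ord_narrow kM) big_ord_recr /= (big_ord_narrow (ltnW kM)).
by congr (_ *m F _); [apply: eq_bigr => i _; congr F; exact: val_inj|exact: val_inj].
Qed.

(** The one-step relation can be iterated only for the full matrix [cols Y], since each [Psi i]
    mixes the columns. Column [j] is extracted once the product over [i < j] is complete. *)
Lemma transported_orbit (Psi : 'I_M -> 'rV[R]_M -> 'M[R]_M) p :
  (forall i p, U p ->
     flow_Hinv (G i) (- p 0 i) (orbit_from G x0 p i) *m cols Y (orbit_from G x0 p i.+1) =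
     cols Y (orbit_from G x0 p i) *m Psi i p) ->
  U p ->
  cols (fun j => transported Y G j p) (orbit_pt G x0 p) =
  cols Y (orbit_pt G x0 p) *m
    \matrix_(u, j) (\big[mulmx/1%:M]_(i < M | (i < j)%N) Psi i p) u j.
Proof.
move=> PsiE Up.
have prodE k : (k <= M)%N ->
    (\big[mulmx/1%:M]_(i < M | (i < k)%N)
      flow_Hinv (G i) (- p 0 i) (orbit_from G x0 p i)) *m cols Y (orbit_from G x0 p k) =
    cols Y (orbit_pt G x0 p) *m \big[mulmx/1%:M]_(i < M | (i < k)%N) Psi i p.
  elim: k => [|k IH] kM; first by rewrite !big_pred0 // mul1mx mulmx1.
  rewrite !(bigmx_ltS _ kM) -mulmxA (PsiE (Ordinal kM)) // mulmxA IH ?(ltnW kM) //.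
  by rewrite mulmxA.
apply/matrixP => u j; rewrite mxE /transported back_pt_orbit ?(ltnW (ltn_ord j)) //.
have -> : \big[mulmx/1%:M]_(i < M | (i < j)%N)
      flow_Hinv (G i) (- p 0 i) (back_pt G p (orbit_pt G x0 p) i) =
    \big[mulmx/1%:M]_(i < M | (i < j)%N)
      flow_Hinv (G i) (- p 0 i) (orbit_from G x0 p i).
  by apply: eq_bigr => i _; rewrite back_pt_orbit // ltnW.
have /matrixP/(_ u j) := prodE j (ltnW (ltn_ord j)).
rewrite mxE => E; rewrite [LHS]mxE.
transitivity (\sum_k (\big[mulmx/1%:M]_(i < M | (i < j)%N)
      flow_Hinv (G i) (- p 0 i) (orbit_from G x0 p i)) u k *
      cols Y (orbit_from G x0 p j) k j).
  by apply: eq_bigr => k _; rewrite [in RHS]mxE.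
rewrite E [LHS]mxE [RHS]mxE; apply: eq_bigr => k _.
by congr (_ * _); rewrite [RHS]mxE.
Qed.

End Transport.

(** * Nonsingularity and smoothness of the coordinate change *)

Lemma continuous_det (R : realType) (T : topologicalType) m (A : T -> 'M[R]_m) x :
  {for x, continuous A} -> {for x, continuous (fun y => \det (A y))}.
Proof.
move=> /continuous_mxP Ac; apply: continuous_sum => s.
apply: continuousM; first exact: cst_continuous.
apply: cvg_big => [|i _]; first exact: mul_continuous.
exact: Ac.
Qed.

Lemma near_unitmx (R : realType) (T : topologicalType) m (A : T -> 'M[R]_m) x :
  {for x, continuous A} -> A x \in unitmx -> \forall y \near x, A y \in unitmx.
Proof.
move=> /continuous_det dc; rewrite unitmxE unitfE -normr_gt0 => dx.
have /cvgrPdist_lt/(_ _ dx) := dc; apply: filterS => y.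
rewrite unitmxE unitfE; apply: contraTneq => ->.
by rewrite subr0 ltxx.
Qed.

Section CoordinateChange.
Variables (R : realType) (M : nat).

(** Column [j] comes from its own product, over the factors with [i < j]. The name refers to this
    range of factors; the matrix need not be triangular. *)
Definition triangular_product (Psi : 'I_M -> 'rV[R]_M -> 'M[R]_M) (p : 'rV[R]_M) :=
  \matrix_(u, j) (\big[mulmx/1%:M]_(i < M | (i < j)%N) Psi i p) u j.

Lemma triangular_product_Ck (U : set 'rV[R]_M) (Psi : 'I_M -> 'rV[R]_M -> 'M[R]_M) :
  open U -> (forall i k u v, Ck_family k U (fun _ p => Psi i p u v)) ->
  forall k u v, Ck_family k U (fun _ p => triangular_product Psi p u v).
Proof.
move=> Uo Psik k u v.
have prod_Ck (P : pred 'I_M) s : forall u v, Ck_family k U (fun _ p =>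
    (\big[mulmx/1%:M]_(i <- s | P i) Psi i p) u v).
  elim: s => [|i s IH] u' v'.
    apply: Ck_family_eq (Ck_family_time Uo k
      (@cst_continuous R R ((1%:M : 'M[R]_M) u' v'))) => // t p _.
    by rewrite big_nil.
  have [Pi|nPi] := boolP (P i).
    apply: Ck_family_eq (Ck_family_mulmx Uo (Psik i k) IH u' v') => // t p _.
    by rewrite big_cons Pi.
  by apply: Ck_family_eq (IH u' v') => // t p _; rewrite big_cons (negbTE nPi).
apply: Ck_family_eq (prod_Ck (fun i => (i < v)%N) (index_enum _) u v) => // s p _.
by rewrite mxE.
Qed.

End CoordinateChange.

Theorem theorem2p5p1 (R : realType) (n m M : nat)
  (g : 'I_m -> 'cV[R]_n -> 'cV[R]_n) (x0 : 'cV[R]_n)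
  (hg : forall i, smooth_on setT (g i))
  (hL : fgo (gen_lie g) x0)
  (Y : 'I_M -> 'cV[R]_n -> 'cV[R]_n)
  (hY : generators (gen_lie g) x0 Y)
  (D : 'I_M -> set (R * 'cV[R]_n))
  (G : 'I_M -> R -> 'cV[R]_n -> 'cV[R]_n)
  (hG : forall i, local_flow (Y i) (D i) (G i))
  (a : 'I_M -> R)
  (ha : orbit_defined D G x0 a)
  (hb : forall p, box a p -> forall i : 'I_M, (i.+1 < M)%N ->
      D i (- p 0 i, back_pt G p (orbit_pt G x0 p) i)) :
  exists (alpha : R) (A : 'rV[R]_M -> 'M[R]_M),
    [/\ 0 < alpha,
        ball (0 : 'rV[R]_M) alpha `<=` box a,
        forall i j, smooth_on (ball (0 : 'rV[R]_M) alpha) (fun p => A p i j),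
        forall p, ball (0 : 'rV[R]_M) alpha p ->
          A p \in unitmx /\
          cols (fun j => transported Y G j p) (orbit_pt G x0 p) =
            cols Y (orbit_pt G x0 p) *m A p
      & A 0 = 1%:M].
Proof.
have Ys i : smooth_on setT (Y i) by exact: gen_lie_smooth hg (hY.1 i).
have [e [r [L Gn]]] := flow_near_all hG ha Ys.
(* Brackets stay in the Lie algebra, so finite generation expands them along the given orbit itself,
   with coefficients smooth on the whole box. *)
have /choice[b Hb] : forall ij : 'I_M * 'I_M, exists c : 'I_M -> 'rV[R]_M -> R,
    (forall l, smooth_on (box a) (c l)) /\ forall p, box a p ->
    lie_bracket (Y ij.1) (Y ij.2) (orbit_pt G x0 p) =
    \sum_l c l p *: Y l (orbit_pt G x0 p).
  move=> [i j].
  exact: (hY.2 _ (gen_lie_bracket (hY.1 i) (hY.1 j)) M Y D G a hY.1 hG ha).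
have bs i j l : smooth_on (box a) (b (i, j) l) by exact: (Hb (i, j)).1.
have bE i j p : box a p -> lie_bracket (Y i) (Y j) (orbit_pt G x0 p) =
    \sum_l b (i, j) l p *: Y l (orbit_pt G x0 p) by exact: (Hb (i, j)).2.
have near_lt d : 0 < d -> \forall p \near (0 : 'rV[R]_M), `|p| < d.
  by move=> d0; apply/nbhs_normP; exists d => // p; rewrite /= sub0r normrN.
(* The bound by [a i] puts the ball inside the box; the three bounds by [e i] are those of
   [near_orbit]. *)
have /nbhs_normP[al0 /= al00 Hal0] : \forall p \near (0 : 'rV[R]_M), forall i : 'I_M,
    [/\ `|(p : 'rV[R]_M) 0 i| < a i, `|p 0 i| < e i, `|orbit_from G x0 p i - x0| < e i &
      `|orbit_from G x0 p i.+1 - x0| < e i].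
  apply: (@filter_forall _ _ _ (nbhs (0 : 'rV[R]_M))) => i.
  have ei := flow_near_gt0 (Gn i).
  near=> p; split.
  - by apply: le_lt_trans (mx_norm_coord _ _ _) _; near: p; apply/near_lt/ha.1.
  - by apply: le_lt_trans (mx_norm_coord _ _ _) _; near: p; exact: near_lt.
  - by near: p; apply: (orbit_from_near Gn) => //; exact: ltnW.
  - by near: p; apply: (orbit_from_near Gn).
pose U := ball (0 : 'rV[R]_M) al0.
have UE p : U p -> `|0 - p| < al0 by rewrite /U -ball_normE.
have Uo : open U by exact: ball_open.
have U0 : U 0 by exact: ballxx.
have Ua : U `<=` box a.
  by move=> p /UE/Hal0 H i; have [h _ _ _] := H i; rewrite -ltr_norml.
have Un p : U p -> near_orbit G x0 e p.
  by move=> /UE/Hal0 H i; have [_ h1 h2 h3] := H i.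
have /choice[Psi HPsi] := transport_step hG ha Ys Gn bs bE Uo Ua Un.
pose A := triangular_product Psi.
have ACk : forall k u v, Ck_family k U (fun _ p => A p u v).
  by apply: triangular_product_Ck => // i k u v; have [h _ _] := HPsi i; exact: h.
have As u v : smooth_on U (fun p => A p u v).
  by apply: Ck_family_smooth_on => // k; exact: ACk.
have A0 : A 0 = 1%:M.
  apply/matrixP => u j; rewrite mxE big1 // => i _.
  by have [_ h _] := HPsi i; exact: h.
have Ac : {for 0, continuous A}.
  apply/continuous_mxP => u v.
  exact: differentiable_continuous (smooth_on_differentiable (As u v) U0).
(* Continuity of the determinant at 0, where [A] is the identity; this shrinks the ball a second
   time. *)
have : \forall p \near (0 : 'rV[R]_M), A p \in unitmx.
  by apply: near_unitmx Ac _; rewrite A0 unitmx1.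
move=> /nbhs_normP[al1 /= al10 Hal1].
pose al := Num.min al0 al1.
have alU : ball (0 : 'rV[R]_M) al `<=` U.
  by apply: le_ball; rewrite ge_min lexx.
exists al, A; split => //.
- by rewrite lt_min al00.
- by move=> p /alU; exact: Ua.
- by move=> u v k; apply: Ck_on_sub alU (As u v k).
- move=> p pal; have Up := alU _ pal; split.
    apply: Hal1; move: pal; rewrite -ball_normE /= => h.
    by apply: lt_le_trans h _; rewrite ge_min lexx orbT.
  apply: (transported_orbit Gn Un) Up.
  by move=> i q Uq; have [_ _ h] := HPsi i; exact: h.
Unshelve. all: by end_near. Qed.
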